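(* Let $1\le k\le d$ be integers, and let $u_1,\dots,u_{k-1}\in\mathbb{R}^d$ be arbitrary vectors. Given $d+1$ mass assignments $\mu_0,\dots,\mu_d$ on the $k$-dimensional linear subspaces of $\mathbb{R}^d$, there exist a $k$-dimensional linear subspace $L$ of $\mathbb{R}^d$ containing $u_1,\dots,u_{k-1}$ and a sphere $\Sigma$ in $L$ (possibly degenerate, i.e. a hyperplane of $L$) such that the closed region of $L$ bounded by $\Sigma$ (the closed ball, or a closed half-space in the degenerate case) contains exactly half of each of the mass distributions $\mu_0^L,\dots,\mu_d^L$. *)

(* Defs.v *)
From HB Require Import structures.
From mathcomp Require Import all_boot all_order all_algebra.
From mathcomp Require Import all_classical all_reals all_analysis.
Set Implicit Arguments. Unset Strict Implicit. Unset Printing Implicit Defensive.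
Import Order.TTheory GRing.Theory Num.Theory.
Import numFieldNormedType.Exports.
Local Open Scope classical_set_scope.
Local Open Scope ring_scope.

Notation borelR R d := (g_sigma_algebraType (@open 'rV[R]_d)).

Section Defs.
Variables (R : realType) (d : nat).

Definition vecR := 'rV[R]_d.

Definition dotR (x y : 'rV[R]_d) : R := \sum_(i < d) x ord0 i * y ord0 i.
Definition sqnormR (x : 'rV[R]_d) : R := dotR x x.

Definition sub_set (L : {vspace 'rV[R]_d}) : set 'rV[R]_d := [set x | x \in L].

Definition is_orth_proj (L : {vspace 'rV[R]_d}) (P : 'M[R]_d) : Prop :=
  P^T = P /\ P *m P = P /\ (forall x : 'rV[R]_d, x \in L <-> x *m P = x).

(* A has k-dimensional Hausdorff measure zero: for every eps > 0 it is covered by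
   countably many balls of radii r_n with sum r_n^k < eps.  On a k-dimensional
   subspace these are exactly the sets of k-dimensional Lebesgue measure zero. *)
Definition hk_null (k : nat) (A : set 'rV[R]_d) : Prop :=
  forall eps : R, 0 < eps -> exists (c : nat -> 'rV[R]_d) (r : nat -> R),
    (forall n, 0 <= r n) /\
    A `<=` \bigcup_n [set x | sqnormR (x - c n) < r n ^+ 2] /\
    (\sum_(0 <= n <oo) ((r n ^+ k)%:E) < eps%:E)%E.

Definition mass_distribution_on (k : nat) (L : {vspace 'rV[R]_d})
    (mu : {measure set (borelR R d) -> \bar R}) : Prop :=
  (mu setT < +oo)%E /\
  mu (~` (sub_set L : set (borelR R d))) = 0%E /\
  (forall A : set (borelR R d), measurable A -> (A `<=` sub_set L) -> hk_null k A -> mu A = 0%E).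

(* A mass assignment on the Grassmannian G_k(R^d): each k-dimensional linear subspace L
   gets a mass distribution mu L on L, depending continuously on L, where G_k(R^d)
   carries its usual topology (via orthogonal projection matrices) and the measures the
   weak topology (integrals of bounded continuous functions). *)
Definition mass_assignment (k : nat)
    (mu : {vspace 'rV[R]_d} -> {measure set (borelR R d) -> \bar R}) : Prop :=
  (forall L : {vspace 'rV[R]_d}, \dim L = k -> mass_distribution_on k L (mu L)) /\
  (forall f : 'rV[R]_d -> R, continuous f -> (exists M : R, forall x, `|f x| <= M) ->
   forall L : {vspace 'rV[R]_d}, \dim L = k ->
   forall eps : R, 0 < eps -> exists2 delta : R, 0 < delta &
   forall (L' : {vspace 'rV[R]_d}) (P P' : 'M[R]_d), \dim L' = k ->
     is_orth_proj L P -> is_orth_proj L' P' ->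
     (forall i j, `|P i j - P' i j| < delta) ->
     `| fine (\int[mu L]_(x in setT) (f x)%:E) - fine (\int[mu L']_(x in setT) (f x)%:E) | < eps).

Definition closed_ball_in (L : {vspace 'rV[R]_d}) (c : 'rV[R]_d) (r : R) : set 'rV[R]_d :=
  [set x | x \in L /\ sqnormR (x - c) <= r ^+ 2].
Definition closed_halfspace_in (L : {vspace 'rV[R]_d}) (v : 'rV[R]_d) (b : R) : set 'rV[R]_d :=
  [set x | x \in L /\ dotR x v <= b].

Definition sphere_region (L : {vspace 'rV[R]_d}) (B : set 'rV[R]_d) : Prop :=
  (exists (c : 'rV[R]_d) (r : R), c \in L /\ 0 < r /\ B = closed_ball_in L c r) \/
  (exists (v : 'rV[R]_d) (b : R), v \in L /\ v != 0 /\ B = closed_halfspace_in L v b).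

End Defs.

(* Main.v *)
(* Write a sphere or hyperplane of L as the zero set of
   f(x) = <Y, x> + c + e |x|^2.  Fix U of dimension k - 1 containing all u_j, and put
   L_v = U + R w(v), where w maps v <> 0 in R^(p+1), p = d - k, into the orthogonal
   complement of U, and Y = sum_i a_i U_i + b w(v), with y = (c, e, a, b) in R^(k+2).  The
   d + 1 imbalances mu_j(f > 0) - mu_j(f < 0) are functions F_j(v, y), y <> 0, v <> 0, that
   are odd in y and invariant under (v, y) |-> (- v, y with its last coordinate b negated).

   On S^p x S^(k+1) modulo these two involutions, the class x of the double cover
   y |-> - y and the class t of v |-> - v satisfy x^(k+1) (x + t) = 0 and t^(p+1) = 0,
   whence x^(d+1) <> 0 and the F_j have a common zero.  This is made elementary as
   follows: x^n is represented by the cup product of the n coboundaries of the signs of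
   the F_j (a cubical cochain mod 2), evaluated on grids subdividing the product cells
   of S^p x S^(k+1) by discrete Stokes.  A small cube on which it does not vanish sees
   both signs of every F_j, and one concludes by compactness.  Only lower semicontinuity
   of the F_j where they are positive is needed; it follows from weak continuity of the
   mass assignments and the nullity of f = 0. *)
Require Import Defs.
From HB Require Import structures.
From mathcomp Require Import all_boot all_order all_algebra.
From mathcomp Require Import all_classical all_reals all_analysis.
From mathcomp Require Import measurable_realfun.
From mathcomp Require Import zify ring lra.
Import Order.TTheory GRing.Theory Num.Theory.
Import numFieldNormedType.Exports.
Local Open Scope classical_set_scope.
Local Open Scope ring_scope.

Set Implicit Arguments.
Unset Strict Implicit.

(** * Cubical cochains modulo 2 *)

(** The coface map of cubes. Vertices are infinite sequences of naturals of which a cell of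
    dimension [m] reads the first [m] entries, which keeps dimensions out of the types. *)
Definition ins (i a : nat) (t : nat -> nat) : nat -> nat :=
  fun j => if (j < i)%N then t j else if j == i then a else t j.-1.

Lemma ins_comm i j a b t : (i <= j)%N ->
  ins i a (ins j b t) = ins j.+1 b (ins i a t).
Proof.
move=> ij; apply/funext => l; rewrite /ins.
repeat (case: ifPn => //=); move=> *; try lia; congr (t _); lia.
Qed.

Lemma ins_add i a b x t :
  (fun l => ins i a x l + ins i b t l)%N = ins i (a + b) (fun l => (x l + t l)%N).
Proof. by apply/funext => l; rewrite /ins; case: ifP => // _; case: ifP. Qed.

Lemma addbb_ring (x : bool) : x + x = 0. Proof. by case: x. Qed.

Section BoxSum.
Variable N : nat.

(** The summation point is padded by 0 beyond its first [m] entries; this default later supplies the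
    sign of the last coordinate of a hemisphere. *)
Fixpoint boxsum (m : nat) (f : (nat -> nat) -> bool) : bool :=
  if m is m'.+1 then \sum_(a < N) boxsum m' (fun t => f (ins 0 a t))
  else f (fun _ => 0%N).

Lemma boxsum0 m : boxsum m (fun _ => 0) = 0.
Proof. by elim: m => //= m IH; rewrite big1. Qed.

Lemma boxsumD m f g : boxsum m (fun t => f t + g t) = boxsum m f + boxsum m g.
Proof.
elim: m f g => //= m IH f g; rewrite -big_split /=.
by apply: eq_bigr => a _; rewrite IH.
Qed.

Lemma boxsum_sum I (r : seq I) m F :
  boxsum m (fun t => \sum_(i <- r) F i t) = \sum_(i <- r) boxsum m (F i).
Proof.
elim: r => [|i r IH].
  rewrite big_nil -[RHS](boxsum0 m); congr boxsum; apply/funext => t; exact: big_nil.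
rewrite big_cons -IH -boxsumD; congr boxsum; apply/funext => t; exact: big_cons.
Qed.

Lemma eq_boxsum m f g :
  (forall x, (forall l, (m <= l)%N -> x l = 0%N) ->
    (forall l, (l < m)%N -> (x l < N)%N) -> f x = g x) ->
  boxsum m f = boxsum m g.
Proof.
elim: m f g => /= [|m IH] f g h; first by apply: h.
apply: eq_bigr => a _; apply: IH => x hx hx'; apply: h => l.
  by case: l => // l; rewrite /ins /= => /hx.
by case: l => [|l]; rewrite /ins /= => // /hx'.
Qed.

Lemma boxsum_ins i m f : (i <= m)%N ->
  boxsum m.+1 f = \sum_(a < N) boxsum m (fun t => f (ins i a t)).
Proof.
elim: m i f => [|m IH] [|i] f // im.
transitivity (\sum_(a < N) \sum_(b < N) boxsum m (fun t => f (ins 0 a (ins i b t)))).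
  by apply: eq_bigr => a _; exact: (IH i (fun t => f (ins 0 a t))).
rewrite exchange_big /=; apply: eq_bigr => a _; apply: eq_bigr => b _.
by congr boxsum; apply/funext => t; rewrite ins_comm.
Qed.

Lemma boxsum_neq0 m f : boxsum m f ->
  exists x, (forall l, (l < m)%N -> (x l < N)%N) /\ f x.
Proof.
move=> h; apply: contrapT => /forallNP hn; move: h.
rewrite (@eq_boxsum _ _ (fun _ => 0)) ?boxsum0 // => x _ hx.
by case fx: (f x) => //; case: (hn x).
Qed.

End BoxSum.

(** [K t m] is the sign of the [m]-th function at the vertex [t]; a cochain is any boolean function
    of such sign patterns. *)
Local Notation cube := ((nat -> nat) -> nat -> bool).

Definition face (i a : nat) (K : cube) : cube := fun t => K (ins i a t).
Definition shift (x : nat -> nat) (K : cube) : cube := fun t => K (fun l => (x l + t l)%N).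

Definition cobd (m : nat) (G : cube -> bool) (K : cube) : bool :=
  \sum_(i < m.+1) \sum_(a < 2) G (face i a K).

Lemma face_face i j a b K : (i <= j)%N ->
  face j b (face i a K) = face i a (face j.+1 b K).
Proof. by move=> ij; apply/funext => t; rewrite /face ins_comm. Qed.

(** Fixing two coordinates in either order gives the same face of codimension two, so each such face
    is counted twice. *)
Lemma cobd_cobd m G K : cobd m.+1 (cobd m G) K = 0.
Proof.
rewrite /cobd.
pose H (i j : nat) : bool := \sum_(a < 2) \sum_(b < 2) G (face j b (face i a K)).
have E : \sum_(i < m.+2) \sum_(a < 2) \sum_(j < m.+1) \sum_(b < 2) G (face j b (face i a K))
   = \sum_(i < m.+2) \sum_(j < m.+1) H i j.
  by apply: eq_bigr => i _; rewrite exchange_big /=; apply: eq_bigr.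
rewrite {}E.
have HC i j : (i <= j)%N -> H i j = H j.+1 i.
  move=> ij; rewrite /H exchange_big /=; apply: eq_bigr => b _; apply: eq_bigr => a _.
  by rewrite face_face.
(* Split the pairs of directions by [i <= j] or [j < i]; [HC] matches the two halves under the
   reindexing [(i, j) |-> (j + 1, i)]. *)
have -> : \sum_(i < m.+2) \sum_(j < m.+1) H i j
  = \sum_(i < m.+2) \sum_(j < m.+1 | (i <= j)%N) H i j
   + \sum_(i < m.+2) \sum_(j < m.+1 | (j < i)%N) H i j.
  rewrite -big_split; apply: eq_bigr => i _ /=.
  rewrite (bigID (fun j : 'I_m.+1 => (i <= j)%N)) /=; congr (_ + _).
  by apply: eq_bigl => j; rewrite ltnNge.
rewrite [X in _ + X](_ : _ = \sum_(i < m.+2) \sum_(j < m.+1 | (i <= j)%N) H i j) ?addbb_ring //.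
rewrite big_ord_recl [X in X + _]big_pred0 ?add0r; last by move=> j.
rewrite [RHS]big_ord_recr [X in _ = _ + X]big_pred0 ?addr0; last first.
  by move=> j /=; apply: negbTE; rewrite -ltnNge ltn_ord.
under eq_bigr do rewrite big_mkcond.
under [RHS]eq_bigr do rewrite big_mkcond.
rewrite exchange_big /=; apply: eq_bigr => i _; apply: eq_bigr => j _.
rewrite /bump /= add1n ltnS; case: ifP => // ij; rewrite -HC //.
Qed.

(* [degc m] is the cup product of the [m] coboundaries of the 0-cochains
   [K |-> K _ j], [j < m]; the top vertex of a facet plays the role of the last
   vertex of a simplex. *)
Fixpoint degc (m : nat) (K : cube) : bool :=
  if m is m'.+1 then cobd m' (fun F => degc m' F * F (fun _ => 1%N) m') K else 1.

(** A primitive of [degc m.+1], see [degcS]. Unlike [degc] it is not invariant under reversal of all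
    signs; the defect, computed in [dege_neg], drives the recursion on degrees. *)
Definition dege (m : nat) (K : cube) : bool := degc m K * K (fun _ => 1%N) m.

Lemma degcS m : degc m.+1 = cobd m (dege m). Proof. by []. Qed.

(** For [m = 0] the two ends of an edge each contribute 1; beyond that [degc] is a coboundary. *)
Lemma degc_cocycle m K : cobd m (degc m) K = 0.
Proof.
case: m => [|m]; last by rewrite degcS cobd_cobd.
by rewrite /cobd big_ord_recl big_ord0 big_ord_recl big_ord_recl big_ord0.
Qed.

Lemma cobdD m G G' K : cobd m (fun F => G F + G' F) K = cobd m G K + cobd m G' K.
Proof.
rewrite /cobd -big_split; apply: eq_bigr => i _; by rewrite -big_split.
Qed.

Definition negc (K : cube) : cube := fun t m => ~~ K t m.

(** Negation changes the cochain under [cobd] by the cocycle [degc m], whose coboundary vanishes. *)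
Lemma degc_neg m K : degc m (negc K) = degc m K.
Proof.
elim: m K => //= m IH K.
rewrite -[RHS]addr0 -[X in _ = _ + X](degc_cocycle m K) -cobdD.
rewrite /cobd; apply: eq_bigr => i _; apply: eq_bigr => a _.
rewrite -[face i a (negc K)]/(negc (face i a K)) IH /negc.
by case: (degc m _); case: (face i a K _ m).
Qed.

Lemma dege_neg m K : dege m (negc K) = dege m K + degc m K.
Proof. by rewrite /dege degc_neg /negc; case: (degc m K); case: (K _ m). Qed.

(** The sign of index [m - 1], if constant, factors out of the last coboundary and leaves the
    coboundary of a cocycle; a constant sign of lower index is inherited by all facets. By
    contraposition, a nonzero value makes every function change sign on the cube. *)
Lemma degc_const m j (b : bool) K : (j < m)%N ->
  (forall t, (forall l, (t l <= 1)%N) -> K t j = b) -> degc m K = 0.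
Proof.
elim: m K => // m IH K jm hK.
have hf (i : 'I_m.+1) (a : 'I_2) t : (forall l, (t l <= 1)%N) -> face i a K t j = b.
  move=> ht; apply: hK => l; rewrite /ins; case: ifP => // _; case: ifP => // _.
  by rewrite -ltnS.
move: jm; rewrite ltnS leq_eqVlt => /orP [/eqP jm|jm]; last first.
  rewrite /= /cobd big1 // => i _; rewrite big1 // => a _.
  by rewrite IH ?mul0r //; exact: hf.
subst j; rewrite /= /cobd.
under eq_bigr do (under eq_bigr do rewrite hf //).
under eq_bigr do rewrite -mulr_suml.
by rewrite -mulr_suml -/(cobd m (degc m) K) degc_cocycle mul0r.
Qed.

(** * Sums over grids and discrete Stokes *)

Section GridSum.
Variable N : nat.

Definition gridsum (m : nat) (G : cube -> bool) (K : cube) : bool :=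
  boxsum N m (fun x => G (shift x K)).

Lemma gridsumD m G G' K : gridsum m (fun F => G F + G' F) K = gridsum m G K + gridsum m G' K.
Proof. exact: boxsumD. Qed.

Lemma telescope_mod2 (f : nat -> bool) n : \sum_(a < n) (f a + f a.+1) = f 0%N + f n.
Proof.
elim: n => [|n IH]; first by rewrite big_ord0 addbb_ring.
by rewrite big_ord_recr /= IH; case: (f 0%N); case: (f n); case: (f n.+1).
Qed.

Lemma shift_face i a b x K : face i b (shift (ins i a x) K) = shift x (face i (a + b) K).
Proof. by apply/funext => t; rewrite /face /shift ins_add. Qed.

(** Discrete Stokes: facets interior to the grid are shared by two unit cubes and telescope modulo
    2. *)
Lemma gridsum_cobd m G K : gridsum m.+1 (cobd m G) K =
  \sum_(i < m.+1) (gridsum m G (face i 0 K) + gridsum m G (face i N K)).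
Proof.
rewrite /gridsum /cobd boxsum_sum; apply: eq_bigr => i _.
rewrite (@boxsum_ins _ i) -1?ltnS //.
rewrite -(telescope_mod2 (fun a => boxsum N m (fun x => G (shift x (face i a K))))).
apply: eq_bigr => a _; rewrite -boxsumD; congr boxsum; apply/funext => x.
by rewrite big_ord_recl big_ord_recl big_ord0 addr0 !shift_face /= addn0 addn1.
Qed.

End GridSum.

(** * Cells of a product of spheres *)

(** The values pair up along the irrelevant sign [c] and cancel. This is how facets that are shared
    by two cells, or collapsed, disappear. *)
Lemma boxsum_indep m c f : (c < m)%N ->
  (forall e e', (forall l, l != c -> e l = e' l) -> f e = f e') -> boxsum 2 m f = 0.
Proof.
case: m => // m; rewrite ltnS => cm hf; rewrite (boxsum_ins _ _ cm).
rewrite big_ord_recl big_ord_recl big_ord0 addr0 /=.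
rewrite [X in _ + X](_ : _ = boxsum 2 m (fun t => f (ins c 0 t))) ?addbb_ring //.
by congr boxsum; apply/funext => t; apply: hf => l /negbTE lc; rewrite /ins lc.
Qed.

Definition flipn (m : nat) (e : nat -> nat) : nat -> nat :=
  fun l => if (l < m)%N then (1 - e l)%N else e l.

Lemma boxsum_flip m f : boxsum 2 m f = boxsum 2 m (fun e => f (flipn m e)).
Proof.
elim: m f => [|m IH] f //=.
rewrite 2!big_ord_recl big_ord0 addr0 addrC 2!big_ord_recl big_ord0 addr0 /=.
have E a : (a < 2)%N -> forall x, ins 0 (1 - a) (flipn m x) = flipn m.+1 (ins 0 a x).
  by move=> _ x; apply/funext => -[|l]; rewrite /flipn /ins //= ltnS.
congr (_ + _); rewrite IH; congr boxsum; apply/funext => e; rewrite -E //.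
Qed.

Section Cells.
Variables (R : realType) (N : nat).

Implicit Types (e t : nat -> nat) (s : nat -> (nat -> R) -> (nat -> R) -> bool).

Definition unitv (i : nat) : nat -> R := fun l => (l == i)%:R.

(* With [e] ranging over the signs of the first [i] coordinates and [e i = 0], these
   maps cover a hemisphere of the [i]-dimensional l^1-sphere. *)
Fixpoint J (i : nat) e t : nat -> R :=
  if i is i'.+1 then
    fun l => (t i')%:R / N%:R * J i' e t l + (1 - (t i')%:R / N%:R) * ((-1) ^+ e i * unitv i l)
  else fun l => (-1) ^+ e 0%N * unitv 0 l.

Lemma J_ext i e e' t t' : (forall l, (l <= i)%N -> e l = e' l) ->
  (forall l, (l < i)%N -> t l = t' l) -> J i e t = J i e' t'.
Proof.
elim: i => /= [|i IH] he ht; first by rewrite he.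
by rewrite IH ?ht ?he // => l li; [apply: he; lia | apply: ht; lia].
Qed.

(** At [t c = 0] the recursion restarts from a vertex on axis [c.+1] and forgets all earlier signs,
    [e 0] among them. *)
Lemma J_bot i c e e' t : (c < i)%N -> t c = 0%N ->
  (forall l, l != 0%N -> e l = e' l) -> J i e t = J i e' t.
Proof.
elim: i => // i IH ci tc he; apply/funext => l /=.
have [ci'|ci'] := ltnP c i; first by rewrite IH // he.
have ? : c = i by lia.
by subst c; rewrite tc !mul0r subr0 !add0r he.
Qed.

Lemma J_opp i e e' t : (forall l, (l <= i)%N -> (e l < 2)%N /\ e' l = (1 - e l)%N) ->
  J i e' t = fun l => - J i e t l.
Proof.
have sgN a : (a < 2)%N -> (-1) ^+ (1 - a) = - (-1) ^+ a :> R.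
  by case: a => [|[|//]] _; rewrite ?expr1 ?expr0 ?opprK.
elim: i => [|i IH] he /=; apply/funext => l.
  by have [h ->] := he 0%N isT; rewrite sgN // mulNr.
have [h ->] := he i.+1 (leqnn _); rewrite sgN // IH; first by ring.
by move=> l' hl; apply: he; lia.
Qed.

Lemma J_neq0 i e t : exists2 l, (l <= i)%N & J i e t l != 0.
Proof.
elim: i => [|i [l li Jl]] /=.
  by exists 0%N => //; rewrite /unitv eqxx mulr1 signr_eq0.
have [ti|ti] := eqVneq ((t i)%:R / N%:R : R) 0; last first.
  exists l; first lia.
  rewrite /unitv (_ : (l == i.+1) = false); last lia.
  by rewrite !mulr0 addr0 mulf_neq0.
by exists i.+1 => //; rewrite ti mul0r add0r subr0 mul1r /unitv eqxx mulr1 signr_eq0.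
Qed.

Lemma J_out i e t l : (i < l)%N -> J i e t l = 0.
Proof.
elim: i => [|i IH] /= il; rewrite /unitv.
  by rewrite (_ : (l == 0)%N = false) ?mulr0 //; lia.
have -> : (l == i.+1)%N = false by lia.
by rewrite IH ?mulr0 ?addr0 //; apply: ltnW.
Qed.

Definition cell s i j e e' : cube :=
  fun t m => s m (J i e t) (J j e' (fun l => t (i + l)%N)).

(** By the padding of [boxsum], [e i = 0] and [e' j = 0]: the sum covers a product of two
    hemispheres, of dimensions [i] and [j]. *)
Definition prodsum s i j (G : cube -> bool) : bool :=
  boxsum 2 i (fun e => boxsum 2 j (fun e' => gridsum N (i + j) G (cell s i j e e'))).

Definition antiL s : nat -> (nat -> R) -> (nat -> R) -> bool :=
  fun m x y => s m (fun l => - x l) y.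
Definition antiR s : nat -> (nat -> R) -> (nat -> R) -> bool :=
  fun m x y => s m x (fun l => - y l).

Definition facesum s i j n G c a : bool :=
  boxsum 2 i (fun e => boxsum 2 j (fun e' => gridsum N n G (face c a (cell s i j e e')))).

Lemma insL i c a t : (c < i.+1)%N ->
  (fun l => ins c a t (i.+1 + l)%N) = (fun l => t (i + l)%N).
Proof.
move=> ci; apply/funext => l; rewrite /ins.
have -> : (i.+1 + l < c)%N = false by lia.
by have -> : (i.+1 + l == c)%N = false by lia.
Qed.

Lemma insR i c a t : (fun l => ins (i + c) a t (i + l)%N) = ins c a (fun l => t (i + l)%N).
Proof.
apply/funext => l; rewrite /ins ltn_add2l eqn_add2l.
by case: ifP => // ?; case: ifP => // ?; congr t; lia.
Qed.

Lemma insJ i c a e t : J i e (ins (i + c) a t) = J i e t.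
Proof. by apply: J_ext => // l li; rewrite /ins (_ : (l < i + c)%N) //; lia. Qed.

Lemma faceL0 s i j n G c : (c < i)%N -> facesum s i j n G c 0 = 0.
Proof.
move=> ci; rewrite /facesum; apply: (@boxsum_indep _ 0) => [|e e' he]; first lia.
congr boxsum; apply/funext => e1; congr gridsum.
apply/funext => t; apply/funext => m; rewrite /face /cell.
rewrite (@J_bot _ c e e') //; by rewrite /ins ltnn eqxx.
Qed.

Lemma faceR0 s i j n G c : (c < j)%N -> facesum s i j n G (i + c) 0 = 0.
Proof.
move=> cj; rewrite /facesum -[RHS](boxsum0 2 i); congr boxsum; apply/funext => e0.
apply: (@boxsum_indep _ 0) => [|e e' he]; first lia.
congr gridsum.
apply/funext => t; apply/funext => m; rewrite /face /cell insR.
rewrite (@J_bot _ c e e') //; by rewrite /ins ltnn eqxx.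
Qed.

Lemma J_ins0 i e t : (forall l, (i <= l)%N -> e l = 0%N) -> J i (ins i 0 e) t = J i e t.
Proof.
move=> he; apply: J_ext => // l li; rewrite /ins.
by case: ifP => // h1; rewrite (_ : l == i) ?he //; lia.
Qed.

Lemma J_ins1 i e t : (forall l, (i <= l)%N -> e l = 0%N) ->
  (forall l, (l < i)%N -> (e l < 2)%N) -> J i (ins i 1 (flipn i e)) t = fun l => - J i e t l.
Proof.
move=> he he2; apply: J_opp => // l li; rewrite /ins /flipn.
case: ifP => // h1; first by rewrite h1 he2.
have -> : l = i by lia.
by rewrite eqxx he.
Qed.

Hypothesis N_gt0 : (0 < N)%N.

Lemma NN1 : N%:R / N%:R = 1 :> R.
Proof. by rewrite divff // pnatr_eq0 -lt0n. Qed.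

Lemma J_top i e t : J i.+1 e (ins i N t) = J i e t.
Proof.
apply/funext => l /=; rewrite {1 3}/ins ltnn eqxx NN1 subrr mul0r addr0 mul1r.
by rewrite (@J_ext _ _ e _ t) // => l' hl; rewrite /ins hl.
Qed.

(** At [t c = N] the weight of the vertex on axis [c.+1] vanishes, and its sign is lost. *)
Lemma J_mid i c e e' t : (c < i)%N -> t c = N ->
  (forall l, l != c.+1 -> e l = e' l) -> J i e t = J i e' t.
Proof.
elim: i => // i IH ci tc he; apply/funext => l /=.
have [ci'|ci'] := ltnP c i; first by rewrite IH // he //; lia.
have ? : c = i by lia.
subst c; rewrite tc NN1 subrr !mul0r !addr0 !mul1r.
by rewrite (@J_ext _ e e' t t) // => l' hl; apply: he; lia.
Qed.

Lemma faceLmid s i j n G c : (c.+1 < i)%N -> facesum s i j n G c N = 0.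
Proof.
move=> ci; rewrite /facesum; apply: (@boxsum_indep _ c.+1) => [|e e' he]; first lia.
congr boxsum; apply/funext => e1; congr gridsum.
apply/funext => t; apply/funext => m; rewrite /face /cell.
rewrite (@J_mid _ c e e') //; first lia; by rewrite /ins ltnn eqxx.
Qed.

Lemma faceRmid s i j n G c : (c.+1 < j)%N -> facesum s i j n G (i + c) N = 0.
Proof.
move=> cj; rewrite /facesum -[RHS](boxsum0 2 i); congr boxsum; apply/funext => e0.
apply: (@boxsum_indep _ c.+1) => [|e e' he]; first lia.
congr gridsum.
apply/funext => t; apply/funext => m; rewrite /face /cell insR.
rewrite (@J_mid _ c e e') //; first lia; by rewrite /ins ltnn eqxx.
Qed.

(** This facet is the equator of the left hemisphere, a full sphere of dimension [i]. The cells with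
    [e i = 0] form its standard hemisphere; those with [e i = 1], once the other signs are reversed,
    form the antipodal one. *)
Lemma faceLtop s i j G : facesum s i.+1 j (i + j) G i N =
  prodsum s i j G + prodsum (antiL s) i j G.
Proof.
rewrite /facesum (@boxsum_ins _ i) // 2!big_ord_recl big_ord0 addr0 /=.
congr (_ + _).
  rewrite /prodsum; apply: eq_boxsum => e he _; congr boxsum; apply/funext => e1.
  congr gridsum; apply/funext => t; apply/funext => m; rewrite /face /cell.
  by rewrite insL // J_top J_ins0.
rewrite boxsum_flip; rewrite /prodsum; apply: eq_boxsum => e he he2.
congr boxsum; apply/funext => e1.
congr gridsum; apply/funext => t; apply/funext => m; rewrite /face /cell.
by rewrite insL // J_top J_ins1.
Qed.

Lemma faceRtop s i j G : facesum s i j.+1 (i + j) G (i + j) N =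
  prodsum s i j G + prodsum (antiR s) i j G.
Proof.
rewrite /facesum /prodsum -boxsumD; congr boxsum; apply/funext => e0.
rewrite (@boxsum_ins _ j) // 2!big_ord_recl big_ord0 addr0 /=.
congr (_ + _).
  apply: eq_boxsum => e he _.
  congr gridsum; apply/funext => t; apply/funext => m; rewrite /face /cell.
  by rewrite insR insJ J_top J_ins0.
rewrite boxsum_flip; apply: eq_boxsum => e he he2.
congr gridsum; apply/funext => t; apply/funext => m; rewrite /face /cell.
by rewrite insR insJ J_top J_ins1.
Qed.

Definition bdL s i j G : bool :=
  if i is i'.+1 then prodsum s i' j G + prodsum (antiL s) i' j G else 0.
Definition bdR s i j G : bool :=
  if j is j'.+1 then prodsum s i j' G + prodsum (antiR s) i j' G else 0.

Lemma sum_last (F : nat -> bool) m : (forall c, (c.+1 < m)%N -> F c = 0) ->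
  \sum_(0 <= c < m) F c = if m is m'.+1 then F m' else 0.
Proof.
case: m => [|m] h; first by rewrite big_geq.
by rewrite big_nat_recr //= big_nat_cond big1 ?add0r // => c hc; apply: h; lia.
Qed.

(** Stokes on a product of two hemispheres: bottom facets and inner gluings cancel, and the two
    equators remain. *)
Lemma prodsum_cobd s i j n G : (i + j = n.+1)%N ->
  prodsum s i j (cobd n G) = bdL s i j G + bdR s i j G.
Proof.
move=> ijn; rewrite /prodsum ijn.
transitivity (\sum_(c < n.+1) (facesum s i j n G c 0 + facesum s i j n G c N)).
  rewrite /facesum.
  under [RHS]eq_bigr do rewrite -boxsumD.
  rewrite -boxsum_sum; congr boxsum; apply/funext => e.
  under [RHS]eq_bigr do rewrite -boxsumD.
  rewrite -boxsum_sum; congr boxsum; apply/funext => e'.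
  exact: gridsum_cobd.
rewrite -(big_mkord xpredT (fun c => facesum s i j n G c 0 + facesum s i j n G c N)).
rewrite -ijn (@big_cat_nat _ _ _ i) //= ?leq_addr //; congr (_ + _).
  rewrite sum_last => [|c ci]; last by rewrite faceL0 ?faceLmid ?addr0 //; lia.
  case: i ijn => // i' ijn; rewrite faceL0 // add0r.
  by rewrite /bdL -faceLtop; congr facesum; lia.
rewrite -{1}[i]add0n big_addn addKn.
under eq_bigr do rewrite addnC.
rewrite (@sum_last (fun c =>
  facesum s i j n G (i + c) 0 + facesum s i j n G (i + c) N)) => [|c ci]; last by rewrite faceR0 ?faceRmid ?addr0 //; lia.
case: j ijn => // j' ijn; rewrite faceR0 // add0r.
by rewrite /bdR -faceRtop; congr facesum; lia.
Qed.

End Cells.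

(** * The mod 2 degree *)

Section Parity.
Variables (R : realType) (N : nat).
Hypothesis N_gt0 : (0 < N)%N.
Variables (p q : nat).
Hypothesis q_gt0 : (0 < q)%N.
Variable s : nat -> (nat -> R) -> (nat -> R) -> bool.

Definition flip_last (y : nat -> R) : nat -> R := fun l => if l == q then - y l else y l.

Hypothesis s_odd : forall m (x y : nat -> R),
  (exists2 l, (l <= p)%N & x l != 0) -> (exists2 l, (l <= q)%N & y l != 0) ->
  s m x (fun l => - y l) = ~~ s m x y.
Hypothesis s_even : forall m (x y : nat -> R),
  (exists2 l, (l <= p)%N & x l != 0) -> (exists2 l, (l <= q)%N & y l != 0) ->
  s m (fun l => - x l) (flip_last y) = s m x y.

Let J_neq0_le r i e t : (i <= r)%N -> exists2 l, (l <= r)%N & J R N i e t l != 0.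
Proof. by move=> ir; have [l li h] := @J_neq0 R N i e t; exists l => //; lia. Qed.

(** Reversing all coordinates but the last is the antipode composed with the reflection in the last
    one. *)
Lemma J_flip j e t : (forall l, (l < j)%N -> (e l < 2)%N) ->
  J R N j (flipn j e) t = fun l => if l == j then J R N j e t l else - J R N j e t l.
Proof.
move=> he; apply/funext => l; case: j he => [|j] he.
  by rewrite (@J_ext _ _ 0 _ e t t) //= /unitv; case: eqP => // _; rewrite mulr0 oppr0.
rewrite /= (@J_opp R N j e); last first.
  move=> l' hl; have hl' : (l' < j.+1)%N by [].
  by rewrite /flipn hl' he.
rewrite {1}/flipn ltnn /unitv; case: (eqVneq l j.+1) => [->|_].
  by rewrite J_out // !mulr0 oppr0 mulr0.
by rewrite !mulr0 !addr0 mulrN.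
Qed.

Lemma prodsum_antiR i j n : (i <= p)%N -> (j <= q)%N ->
  prodsum N (antiR s) i j (dege n) = prodsum N s i j (dege n) + prodsum N s i j (degc n).
Proof.
move=> ip jq; rewrite /prodsum -boxsumD; congr boxsum; apply/funext => e.
rewrite -boxsumD; congr boxsum; apply/funext => e'.
rewrite -gridsumD /gridsum; congr boxsum; apply/funext => x.
rewrite -dege_neg; congr dege; apply/funext => t; apply/funext => m.
by rewrite /shift /cell /antiR /negc s_odd //; apply: J_neq0_le.
Qed.

(** For [j < q] the right-hand cells lie where coordinate [q] is zero, and [flip_last] fixes such
    points. *)
Lemma prodsum_antiL_lt i j n : (i <= p)%N -> (j < q)%N ->
  prodsum N (antiL s) i j (dege n) = prodsum N s i j (dege n).
Proof.
move=> ip jq; rewrite /prodsum; congr boxsum; apply/funext => e.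
congr boxsum; apply/funext => e'; congr gridsum; apply/funext => t; apply/funext => m.
rewrite /cell /antiL -[RHS]s_even; [|exact: J_neq0_le|apply: J_neq0_le; exact: ltnW].
congr s; apply/funext => l; rewrite /flip_last; case: eqP => // ->.
by rewrite J_out // oppr0.
Qed.

(** [s_even] trades the antipode on the left for [flip_last] on the right, which differs from the
    antipode by the reflection that [flipn] performs on the cells. *)
Lemma prodsum_antiL_q i n : (i <= p)%N ->
  prodsum N (antiL s) i q (dege n) = prodsum N (antiR s) i q (dege n).
Proof.
move=> ip; rewrite /prodsum; congr boxsum; apply/funext => e.
rewrite [RHS]boxsum_flip; apply: eq_boxsum => e' _ he'.
congr gridsum; apply/funext => t; apply/funext => m.
rewrite /cell /antiL /antiR J_flip //.
set x := J R N i _ _; set y := J R N q _ _.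
have -> : y = flip_last (fun l => - (if l == q then y l else - y l)).
  by apply/funext => l; rewrite /flip_last; case: (l == q); rewrite /= ?opprK.
rewrite s_even.
- by congr s; apply/funext => l; rewrite /flip_last; case: (l == q); rewrite /= ?opprK.
- exact: J_neq0_le.
- have [l lq h] := @J_neq0_le q q e' (fun l => t (i + l)%N) (leqnn _).
  by exists l => //; case: ifP; rewrite ?opprK ?oppr_eq0.
Qed.

(** The value of [x^(i+j)] on a product of hemispheres. By Stokes, the right equator always
    contributes [celldeg i j.-1], while the left one contributes only when [j = q]. *)
Definition celldeg i j := prodsum N s i j (degc (i + j)).

Lemma bdR_dege i j : (i <= p)%N -> (j < q)%N ->
  bdR N s i j.+1 (dege (i + j)) = celldeg i j.
Proof.
by move=> ip jq; rewrite /bdR prodsum_antiR // 1?ltnW // addrA addbb_ring add0r.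
Qed.

Lemma bdL_dege_lt i j : (i < p)%N -> (j < q)%N -> bdL N s i.+1 j (dege (i + j)) = 0.
Proof. by move=> ip jq; rewrite /bdL prodsum_antiL_lt // 1?ltnW // addbb_ring. Qed.

Lemma bdL_dege_q i : (i < p)%N -> bdL N s i.+1 q (dege (i + q)) = celldeg i q.
Proof.
move=> ip; rewrite /bdL prodsum_antiL_q 1?ltnW // prodsum_antiR // 1?ltnW //.
by rewrite addrA addbb_ring add0r.
Qed.

Lemma celldeg_rec i j n : (i + j = n.+1)%N ->
  celldeg i j = bdL N s i j (dege n) + bdR N s i j (dege n).
Proof. by move=> ijn; rewrite /celldeg ijn degcS (@prodsum_cobd _ _ N_gt0). Qed.

Lemma celldeg0 j : (j <= q)%N -> celldeg 0 j = 1.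
Proof.
elim: j => [|j IH] jq; first by [].
by rewrite (@celldeg_rec _ _ (0 + j)) // bdR_dege // IH 1?ltnW // add0r.
Qed.

Lemma celldegS i j : (i < p)%N -> (j < q)%N -> celldeg i.+1 j = 0.
Proof.
move=> ip; elim: j => [|j IH] jq.
  by rewrite (@celldeg_rec _ _ (i + 0)) ?addSn // bdL_dege_lt // addr0.
rewrite (@celldeg_rec _ _ (i + j.+1)) // bdL_dege_lt // add0r.
by rewrite -addSnnS bdR_dege ?IH // ltnW.
Qed.

(** [celldeg i.+1 q] is the sum of [celldeg i q = 1] and of [celldeg i.+1 q.-1 = 0]. *)
Lemma celldeg_q i : (i <= p)%N -> celldeg i q = 1.
Proof.
elim: i => [|i IH] ip; first exact: celldeg0.
rewrite (@celldeg_rec _ _ (i + q)) // bdL_dege_q // IH 1?ltnW //.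
have qE : q = q.-1.+1 by rewrite prednK.
have -> : bdR N s i.+1 q (dege (i + q)) = celldeg i.+1 q.-1.
  by rewrite qE -addSnnS bdR_dege //= -qE.
by rewrite celldegS // ?addr0 // {2}qE.
Qed.

(** Since the total degree is 1, [degc] is nonzero on some unit cube of the grid, and [degc_const]
    then forbids a constant sign there. *)
Lemma exists_mixed_cell : exists e e' x : nat -> nat,
  (forall l, (l < p + q)%N -> (x l < N)%N) /\
  forall m (b : bool), (m < p + q)%N -> exists t : nat -> nat,
    (forall l, (t l <= 1)%N) /\
    s m (J R N p e (fun l => x l + t l)%N)
        (J R N q e' (fun l => x (p + l)%N + t (p + l)%N)%N) = b.
Proof.
have h : boxsum 2 p (fun e => boxsum 2 q (fun e' =>
  gridsum N (p + q) (degc (p + q)) (cell N s p q e e'))) by exact: celldeg_q.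
have [e [_ /boxsum_neq0 [e' [_ /boxsum_neq0 [x [xN hx]]]]]] := boxsum_neq0 h.
exists e, e', x; split=> // m b mpq; apply: contrapT => /forallNP hn.
move: hx; rewrite (@degc_const _ m (~~ b)) // => t ht.
have := hn t; rewrite /shift /cell => {}hn.
by case: b hn => hn; case E : (s _ _ _) => //; exfalso; apply: hn.
Qed.

End Parity.

(** * Size and mesh of the grids on the cells *)

Section CellMetric.
Variables (R : realType) (N : nat).
Hypothesis N_gt0 : (0 < N)%N.

Implicit Types (e t u : nat -> nat).

Lemma ratio01 (a : nat) : (a <= N)%N -> 0 <= (a%:R / N%:R : R) <= 1.
Proof. by move=> aN; rewrite divr_ge0 //= ler_pdivrMr ?ltr0n // mul1r ler_nat. Qed.

Lemma signed_unit_le1 (a : nat) i l : `|(-1) ^+ a * unitv R i l| <= 1.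
Proof.
rewrite normrM normrX normrN1 expr1n mul1r /unitv.
by case: (l == i); rewrite ?normr1 ?normr0.
Qed.

Lemma J_le1 i e t l : (forall r, (r < i)%N -> (t r <= N)%N) -> `|J R N i e t l| <= 1.
Proof.
elim: i => [|i IH] ht /=; first exact: signed_unit_le1.
have /andP [a0 a1] := ratio01 (ht i (leqnn _)).
move: a0 a1; set a := (t i)%:R / N%:R => a0 a1.
set E := (-1) ^+ _ * _; rewrite (le_trans (ler_normD _ _)) // (normrM a) (normrM (1 - a)).
rewrite (ger0_norm a0) (@ger0_norm _ (1 - a)) ?subr_ge0 //.
have h1 := signed_unit_le1 (e i.+1) i.+1 l.
have h2 : `|J R N i e t l| <= 1 by apply: IH => r ri; apply: ht; exact: ltnW.
move: h1 h2; rewrite -/E; nra.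
Qed.

(** The functional on the left is 1 at each vertex [(-1) ^+ e l * unitv l], and [J] is an affine
    combination of these. It bounds the l^1 norm of [J] from below. *)
Lemma J_signed_sum i r e t : (i <= r)%N ->
  \sum_(l < r.+1) (-1) ^+ e l * J R N i e t l = 1.
Proof.
have sq a : (-1) ^+ a * (-1) ^+ a = 1 :> R by rewrite -exprMn mulrNN mulr1 expr1n.
have U i' : (i' <= r)%N -> \sum_(l < r.+1) (-1) ^+ e l * ((-1) ^+ e i' * unitv R i' l) = 1.
  move=> ir; rewrite (bigD1 (Ordinal (n:=r.+1) (m:=i') ir)) //= /unitv eqxx mulr1 sq.
  rewrite big1 ?addr0 // => l /eqP li; rewrite (_ : (l == i' :> nat) = false) ?mulr0 //.
  by apply/eqP => h; apply: li; apply/val_inj.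
elim: i => [|i IH] ir /=; first exact: U.
under eq_bigr do rewrite mulrDr mulrCA [X in _ + X]mulrCA.
by rewrite big_split /= -!mulr_sumr IH ?U //; [ring|lia].
Qed.

Lemma J_sum_ge1 i r e t : (i <= r)%N -> 1 <= \sum_(l < r.+1) `|J R N i e t l|.
Proof.
move=> ir; rewrite -(J_signed_sum e t ir); apply: ler_sum => l _.
by rewrite (le_trans (ler_norm _)) // normrM normrX normrN1 expr1n mul1r.
Qed.

(** Each level of the recursion shifts a weight of at most [1 / N] between two points whose
    coordinates differ by at most 2. *)
Lemma J_lipschitz i e t u l : (forall r, (r < i)%N -> (t r + u r <= N)%N) ->
  (forall r, (u r <= 1)%N) ->
  `|J R N i e (fun r => t r + u r)%N l - J R N i e t l| <= (2 * i)%:R / N%:R.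
Proof.
elim: i => [|i IH] ht hu /=; first by rewrite subrr normr0 muln0 mul0r.
have := IH (fun r ri => ht r (ltnW ri)) hu.
have tN : (t i <= N)%N by rewrite (leq_trans _ (ht i (leqnn _))) ?leq_addr.
have /andP [] := ratio01 tN.
have : `|J R N i e (fun r => t r + u r)%N l| <= 1.
  by apply: J_le1 => r ri; apply: ht; exact: ltnW.
have := signed_unit_le1 (e i.+1) i.+1 l.
set E := (-1) ^+ _ * _; set x' := J _ _ _ _ _ _; set x := J _ _ _ _ _ _.
rewrite natrD; set b := (u i)%:R.
move=> hE hx' a0 a1 hx.
have N0 : 0 <= N%:R^-1 :> R by rewrite invr_ge0.
have hb : 0 <= b / N%:R <= N%:R^-1.
  by rewrite mulr_ge0 //= ler_piMl // /b lern1 hu.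
have -> : ((t i)%:R + b) / N%:R * x' + (1 - ((t i)%:R + b) / N%:R) * E -
   ((t i)%:R / N%:R * x + (1 - (t i)%:R / N%:R) * E) =
   (t i)%:R / N%:R * (x' - x) + b / N%:R * (x' - E) by ring.
apply: (le_trans (ler_normD _ _)); rewrite !normrM.
rewrite mulnS natrD mulrDl addrC; apply: lerD; last first.
  by rewrite -normrM (ger0_norm a0) (le_trans _ hx) // ler_piMl.
rewrite -normrM; case/andP: hb => b0 b1; rewrite (ger0_norm b0).
rewrite mulrC; apply: ler_pM => //.
by rewrite (le_trans (ler_normB _ _)) // (le_trans (lerD hx' hE)).
Qed.

End CellMetric.

(** * Common zeros of twisted odd maps *)

Lemma cvg_sumr (R : realType) (T : Type) (F : set_system T) I (r : seq I)
  (f : I -> T -> R) (a : I -> R) : Filter F ->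
  (forall i, f i x @[x --> F] --> a i) ->
  \sum_(i <- r) f i x @[x --> F] --> \sum_(i <- r) a i.
Proof. by move=> FF fa; apply: cvg_big => //; exact: add_continuous. Qed.

Lemma nbhs_rV (R : realType) n (w : 'rV[R]_n) (e : R) : 0 < e ->
  nbhs w [set w' : 'rV[R]_n | forall l, `|w' 0 l - w 0 l| < e].
Proof.
move=> e0; apply/nbhs_ballP; exists e => //= w' [_ hw'] l.
by have := hw' ord0 l; rewrite /ball /= distrC.
Qed.

Section TwistedBorsukUlam.
Variable R : realType.

Definition signv n (v : 'rV[R]_n) : bool :=
  if [pick i | v 0 i != 0] is Some i then 0 < v 0 i else false.

Lemma signvN n (v : 'rV[R]_n) : v != 0 -> signv (- v) = ~~ signv v.
Proof.
move=> v0; rewrite /signv (@eq_pick _ _ (fun i => v 0 i != 0)); last first.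
  by move=> i /=; rewrite mxE oppr_eq0.
case: pickP => [i vi|v0']; first by rewrite mxE oppr_gt0 -leNgt le_eqVlt (negbTE vi).
by case/eqP: v0; apply/rowP => i; rewrite mxE; apply/eqP; rewrite -[_ == _]negbK v0'.
Qed.

Definition flip_max n (y : 'rV[R]_n.+1) : 'rV[R]_n.+1 :=
  \row_l (if l == ord_max then - y 0 l else y 0 l).

(* Breaks ties, equivariantly, where a function [F j] vanishes. *)
Definition tiebreak n m (v : 'rV[R]_n) (y : 'rV[R]_m.+1) : bool :=
  if [pick i | (i != ord_max) && (y 0 i != 0)] is Some i then 0 < y 0 i
  else (0 < y 0 ord_max) == signv v.

Lemma pick_none_last m (y : 'rV[R]_m.+1) :
  y != 0 -> (fun i => (i != ord_max) && (y 0 i != 0)) =1 xpred0 -> y 0 ord_max != 0.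
Proof.
move=> y0 h; apply: contra_neq y0 => ym; apply/rowP => i; rewrite mxE.
by have [->//|im] := eqVneq i ord_max; apply/eqP; move: (h i); rewrite /= im /= => /negbFE.
Qed.

Lemma oppr_gt0_neq (x : R) : x != 0 -> (0 < - x) = ~~ (0 < x).
Proof. by move=> x0; rewrite oppr_gt0 -leNgt le_eqVlt (negbTE x0). Qed.

Lemma tiebreakN n m (v : 'rV[R]_n) (y : 'rV[R]_m.+1) : y != 0 ->
  tiebreak v (- y) = ~~ tiebreak v y.
Proof.
move=> y0; rewrite /tiebreak.
rewrite (@eq_pick _ _ (fun i => (i != ord_max) && (y 0 i != 0))); last first.
  by move=> i /=; rewrite mxE oppr_eq0.
case: pickP => [i /andP [_ yi]|/(pick_none_last y0) ym]; first by rewrite mxE oppr_gt0_neq.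
by rewrite mxE oppr_gt0_neq //; case: (0 < _); case: signv.
Qed.

(** A nonzero coordinate before the last is untouched by the flip; otherwise [0 < y 0 ord_max] and
    [signv v] are both reversed, so that their comparison is not. *)
Lemma tiebreak_flip n m (v : 'rV[R]_n) (y : 'rV[R]_m.+1) : v != 0 -> y != 0 ->
  tiebreak (- v) (flip_max y) = tiebreak v y.
Proof.
move=> v0 y0; rewrite /tiebreak.
rewrite (@eq_pick _ _ (fun i => (i != ord_max) && (y 0 i != 0))); last first.
  by move=> i /=; rewrite mxE; case: (eqVneq i ord_max).
case: pickP => [i /andP [/negbTE im yi]|/(pick_none_last y0) ym]; first by rewrite mxE im.
by rewrite mxE eqxx oppr_gt0_neq // signvN //; case: (0 < _); case: signv.
Qed.

Variables (p q : nat).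
Hypothesis q_gt0 : (0 < q)%N.
Variable F : 'I_(p + q) -> 'rV[R]_p.+1 -> 'rV[R]_q.+1 -> R.
Hypothesis F_odd : forall j (v : 'rV[R]_p.+1) (y : 'rV[R]_q.+1), v != 0 -> y != 0 ->
  F j v (- y) = - F j v y.
Hypothesis F_even : forall j (v : 'rV[R]_p.+1) (y : 'rV[R]_q.+1), v != 0 -> y != 0 ->
  F j (- v) (flip_max y) = F j v y.
Hypothesis F_lsc : forall j (v : 'rV[R]_p.+1) (y : 'rV[R]_q.+1), v != 0 -> y != 0 -> 0 < F j v y ->
  exists2 delta : R, 0 < delta & forall (v' : 'rV[R]_p.+1) (y' : 'rV[R]_q.+1),
    (forall l, `|v' 0 l - v 0 l| < delta) -> (forall l, `|y' 0 l - y 0 l| < delta) ->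
    v' != 0 -> y' != 0 -> 0 < F j v' y'.

Let sgnF j (b : bool) (v : 'rV[R]_p.+1) (y : 'rV[R]_q.+1) : Prop :=
  if b then 0 < F j v y else F j v y < 0.

(** The negative case is the positive one at [- y], by oddness. *)
Lemma F_stable j b (v : 'rV[R]_p.+1) (y : 'rV[R]_q.+1) : v != 0 -> y != 0 -> sgnF j b v y ->
  exists2 delta : R, 0 < delta & forall (v' : 'rV[R]_p.+1) (y' : 'rV[R]_q.+1),
    (forall l, `|v' 0 l - v 0 l| < delta) -> (forall l, `|y' 0 l - y 0 l| < delta) ->
    v' != 0 -> y' != 0 -> sgnF j b v' y'.
Proof.
move=> v0 y0; case: b => /= [|Fn]; first exact: F_lsc.
have yN0 : - y != 0 by rewrite oppr_eq0.
have Fp : 0 < F j v (- y) by rewrite F_odd // oppr_gt0.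
have [d d0 hd] := F_lsc v0 yN0 Fp.
exists d => // v' y' hv hy v'0 y'0.
rewrite /sgnF -oppr_gt0 -F_odd // hd // ?oppr_eq0 // => l.
by rewrite !mxE -opprD normrN.
Qed.

Let toRow n (x : nat -> R) : 'rV[R]_n.+1 := \row_(l < n.+1) x l.

Lemma toRow_neq0 n (x : nat -> R) : (exists2 l, (l <= n)%N & x l != 0) -> toRow n x != 0.
Proof.
case=> l ln; apply: contra_neq => /rowP /(_ (Ordinal (n:=n.+1) (m:=l) ln)).
by rewrite !mxE.
Qed.

Let Fnat m (v : 'rV[R]_p.+1) (y : 'rV[R]_q.+1) : R := if insub m is Some j then F j v y else 0.

Let s m (x y : nat -> R) : bool :=
  let v := toRow p x in let w := toRow q y in
  if 0 < Fnat m v w then true else if Fnat m v w < 0 then false else tiebreak v w.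

Lemma s_odd m (x y : nat -> R) :
  (exists2 l, (l <= p)%N & x l != 0) -> (exists2 l, (l <= q)%N & y l != 0) ->
  s m x (fun l => - y l) = ~~ s m x y.
Proof.
move=> /toRow_neq0 x0 /toRow_neq0 y0; rewrite /s.
have -> : toRow q (fun l => - y l) = - toRow q y by apply/rowP => l; rewrite !mxE.
have -> : Fnat m (toRow p x) (- toRow q y) = - Fnat m (toRow p x) (toRow q y).
  by rewrite /Fnat; case: insub => [j|]; rewrite ?oppr0 // F_odd.
by rewrite oppr_gt0 oppr_lt0 tiebreakN //; case: ltgtP.
Qed.

Lemma s_even m (x y : nat -> R) :
  (exists2 l, (l <= p)%N & x l != 0) -> (exists2 l, (l <= q)%N & y l != 0) ->
  s m (fun l => - x l) (flip_last q y) = s m x y.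
Proof.
move=> /toRow_neq0 x0 /toRow_neq0 y0; rewrite /s.
have -> : toRow p (fun l => - x l) = - toRow p x by apply/rowP => l; rewrite !mxE.
have -> : toRow q (flip_last q y) = flip_max (toRow q y).
  by apply/rowP => l; rewrite !mxE /flip_last -val_eqE.
have -> : Fnat m (- toRow p x) (flip_max (toRow q y)) = Fnat m (toRow p x) (toRow q y).
  by rewrite /Fnat; case: insub => [j|] //; rewrite F_even.
by rewrite tiebreak_flip.
Qed.

(** A compact set avoiding 0 that contains the grid points by [J_le1] and [J_sum_ge1]; it stands in
    for the l^1 sphere. *)
Definition l1shell n : set 'rV[R]_n :=
  [set v | (forall l, v 0 l \in `[-1, 1]) /\ 1 <= \sum_l `|v 0 l|].

Lemma compact_l1shell n : compact (@l1shell n).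
Proof.
have cB : compact [set v : 'rV[R]_n | forall l, `[-1, 1]%classic (v ord0 l)].
  apply: (@rV_compact R n (fun _ => `[-1, 1]%classic)) => i; exact: segment_compact.
apply: (subclosed_compact _ cB); last by move=> v [].
rewrite (_ : @l1shell n = [set v : 'rV[R]_n | forall l, `[-1, 1]%classic (v 0 l)] `&`
    (fun v : 'rV[R]_n => \sum_l `|v 0 l|) @^-1` [set x | 1 <= x]); last first.
  by apply/seteqP; split=> v /=.
apply: closedI; first by apply: compact_closed => //; exact: norm_hausdorff.
apply: closed_comp; last exact: closed_ge.
move=> v _; apply: (@cvg_sumr R _ (nbhs v)) => l.
by apply: cvg_norm; exact: coord_continuous.
Qed.

Lemma l1shell_neq0 n (v : 'rV[R]_n) : l1shell v -> v != 0.
Proof.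
case=> _; apply: contraTneq => ->; rewrite big1 ?ler10 // => l _.
by rewrite mxE normr0.
Qed.

(** Without a common zero, compactness yields one mesh at which, around every point, some [F j]
    keeps a strict sign; a mixed cell of that mesh contradicts this. *)
Theorem twisted_borsuk_ulam :
  exists (v : 'rV[R]_p.+1) (y : 'rV[R]_q.+1), [/\ v != 0, y != 0 & forall j, F j v y = 0].
Proof.
apply: contrapT => /forallNP hno.
have hsgn (v : 'rV[R]_p.+1) (y : 'rV[R]_q.+1) : v != 0 -> y != 0 -> exists j b, sgnF j b v y.
  move=> v0 y0; apply: contrapT => /forallNP h; apply: (hno v); exists y; split=> // j.
  have := h j => /forallNP hj; apply/eqP; rewrite eq_le !leNgt.
  apply/andP; split; apply/negP; [exact: (hj true)|exact: (hj false)].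
(* The radius dominates, for both factors, the bound of [J_lipschitz] on the distance to the base
   vertex of a grid cube of mesh [1 / N.+1]. *)
pose P (N : nat) (z : 'rV[R]_p.+1 * 'rV[R]_q.+1) := exists j b,
  forall (v : 'rV[R]_p.+1) (y : 'rV[R]_q.+1),
  (forall l, `|v 0 l - z.1 0 l| <= (2 * (p + q))%:R / N.+1%:R) ->
  (forall l, `|y 0 l - z.2 0 l| <= (2 * (p + q))%:R / N.+1%:R) ->
  v != 0 -> y != 0 -> sgnF j b v y.
have cK := compact_setX (@compact_l1shell p.+1) (@compact_l1shell q.+1).
have /compact_near_coveringP /(_ _ \oo P _) hP := cK.
have {hP} : \forall N \near \oo, @l1shell p.+1 `*` @l1shell q.+1 `<=` P N.
  apply: hP => -[v y] [/= /l1shell_neq0 v0 /l1shell_neq0 y0].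
  have [j [b hjb]] := hsgn v y v0 y0.
  have [d d0 hd] := F_stable v0 y0 hjb.
  have d20 : 0 < d / 2 by rewrite divr_gt0.
  have hN : \forall N \near \oo, (2 * (p + q))%:R / N.+1%:R < d / 2.
    have e0 : 0 < d / 2 / (2 * (p + q)).+1%:R by rewrite divr_gt0.
    apply: filterS (near_infty_natSinv_lt (PosNum e0)) => N /= hN.
    rewrite ltr_pdivlMr ?ltr0n // in hN.
    apply: le_lt_trans hN; rewrite mulrC ler_wpM2l // ler_nat; lia.
  pose nz (z : 'rV[R]_p.+1 * 'rV[R]_q.+1) := (forall l, `|z.1 0 l - v 0 l| < d / 2) /\
      (forall l, `|z.2 0 l - y 0 l| < d / 2).
  have nvy : nbhs (v, y) nz.
    exists ([set v' : 'rV[R]_p.+1 | forall l, `|v' 0 l - v 0 l| < d / 2],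
            [set y' : 'rV[R]_q.+1 | forall l, `|y' 0 l - y 0 l| < d / 2]) => /=.
      by split; exact: nbhs_rV.
    by case=> v' y' [].
  have tri (a b' c : R) r : `|a - b'| <= r -> r < d / 2 -> `|b' - c| < d / 2 -> `|a - c| < d.
    move=> h1 h2 h3; rewrite (le_lt_trans (ler_distD b' a c)) //.
    by rewrite [d]splitr ltrD // (le_lt_trans h1).
  near=> z N.
  have zN : (2 * (p + q))%:R / N.+1%:R < d / 2 by near: N.
  have [zv zy] : nz z by near: z.
  exists j, b => v' y' hv hy v'0 y'0; apply: hd => // l.
    exact: tri (hv l) zN (zv l).
  exact: tri (hy l) zN (zy l).
case=> N _ /(_ N (leqnn _)) hN.
have [e [e' [x [xN hx]]]] := exists_mixed_cell (ltn0Sn N) q_gt0 s_odd s_even.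
set N1 := N.+1 in xN hx.
have Jshell i (e0 t : nat -> nat) : (forall r, (r < i)%N -> (t r <= N1)%N) ->
   l1shell (toRow i (J R N1 i e0 t)).
  move=> ht; split=> [l|].
    by rewrite mxE in_itv /= -ler_norml; apply: J_le1.
  by under eq_bigr do rewrite mxE; apply: J_sum_ge1.
pose X t := toRow p (J R N1 p e (fun l => x l + t l)%N).
pose Y t := toRow q (J R N1 q e' (fun l => x (p + l)%N + t (p + l)%N)%N).
have hX t : (forall l, (t l <= 1)%N) -> l1shell (X t).
  move=> ht; apply: Jshell => r rp; have := xN r; have := ht r; lia.
have hY t : (forall l, (t l <= 1)%N) -> l1shell (Y t).
  move=> ht; apply: Jshell => r rp; have := xN (p + r)%N; have := ht (p + r)%N; lia.
have hX0 : l1shell (toRow p (J R N1 p e x)).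
  by apply: Jshell => r rp; have := xN r; lia.
have hY0 : l1shell (toRow q (J R N1 q e' (fun l => x (p + l)%N))).
  by apply: Jshell => r rp; have := xN (p + r)%N; lia.
have [j [b hjb]] := hN (_, _) (conj hX0 hY0).
(* Around the base vertex [F j] has the strict sign [b], so no tie is broken there, yet the mixed
   cell has a vertex where [s] reads [~~ b]. *)
have [t [ht]] := hx j (~~ b) (ltn_ord j).
rewrite /s -/(X t) -/(Y t) /Fnat valK.
have : sgnF j b (X t) (Y t).
  have le_nat (a c : nat) : (a <= c)%N -> a%:R / N1%:R <= c%:R / N1%:R :> R.
    by move=> ac; rewrite ler_wpM2r ?invr_ge0 // ler_nat.
  apply: hjb; rewrite ?(l1shell_neq0 (hX t ht)) ?(l1shell_neq0 (hY t ht)) // => l.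
    rewrite !mxE /=; apply: (le_trans (@J_lipschitz R N1 (ltn0Sn N) p e x t l _ _)) => //.
      by move=> r rp; have := xN r; have := ht r; lia.
    by apply: le_nat; lia.
  rewrite !mxE /=.
  apply: (le_trans (@J_lipschitz R N1 (ltn0Sn N) q e'
    (fun r => x (p + r)%N) (fun r => t (p + r)%N) l _ _)) => //.
    by move=> r rp; have := xN (p + r)%N; have := ht (p + r)%N; lia.
  by apply: le_nat; lia.
by rewrite /sgnF; case: b {hjb} => /=; case: (ltgtP 0 (F j (X t) (Y t))).
Unshelve. all: by end_near.
Qed.

End TwistedBorsukUlam.

(** * Sets of null Hausdorff measure *)

Section Dot.
Variables (R : realType) (d : nat).
Implicit Types x y z : 'rV[R]_d.

Lemma dotRC x y : dotR x y = dotR y x.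
Proof. by apply: eq_bigr => i _; rewrite mulrC. Qed.

Lemma dotRDl x y z : dotR (x + y) z = dotR x z + dotR y z.
Proof. by rewrite -big_split; apply: eq_bigr => i _ /=; rewrite mxE mulrDl. Qed.

Lemma dotRZl a x z : dotR (a *: x) z = a * dotR x z.
Proof. by rewrite mulr_sumr; apply: eq_bigr => i _ /=; rewrite mxE mulrA. Qed.

Lemma dotRNl x z : dotR (- x) z = - dotR x z.
Proof. by rewrite -scaleN1r dotRZl mulN1r. Qed.

Lemma dotRBl x y z : dotR (x - y) z = dotR x z - dotR y z.
Proof. by rewrite dotRDl dotRNl. Qed.

Lemma dotRDr x y z : dotR x (y + z) = dotR x y + dotR x z.
Proof. by rewrite !(dotRC x) dotRDl. Qed.

Lemma dotRZr a x z : dotR x (a *: z) = a * dotR x z.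
Proof. by rewrite !(dotRC x) dotRZl. Qed.

Lemma dotRNr x z : dotR x (- z) = - dotR x z.
Proof. by rewrite !(dotRC x) dotRNl. Qed.

Lemma dotRBr x y z : dotR x (y - z) = dotR x y - dotR x z.
Proof. by rewrite !(dotRC x) dotRBl. Qed.

Lemma dotR0l z : dotR 0 z = 0.
Proof. by rewrite -[0 in LHS](scale0r 0) dotRZl mul0r. Qed.

Lemma dotR_suml I (r : seq I) (F : I -> 'rV[R]_d) z :
  dotR (\sum_(i <- r) F i) z = \sum_(i <- r) dotR (F i) z.
Proof.
elim: r => [|i r IH]; first by rewrite !big_nil dotR0l.
by rewrite !big_cons dotRDl IH.
Qed.

Lemma sqnormR_ge0 x : 0 <= sqnormR x.
Proof. by apply: sumr_ge0 => i _; exact: sqr_ge0. Qed.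

Lemma sqnormR_eq0 x : (sqnormR x == 0) = (x == 0).
Proof.
rewrite psumr_eq0 => [|i _]; last exact: sqr_ge0.
apply/allP/eqP => [h|-> i _]; last by rewrite /= mxE mul0r eqxx.
apply/rowP => i; rewrite mxE; apply/eqP.
by have := h i (mem_index_enum i); rewrite /= mulf_eq0 orbb.
Qed.

Lemma sqnormR_gt0 x : x != 0 -> 0 < sqnormR x.
Proof. by move=> x0; rewrite lt_def sqnormR_eq0 x0 sqnormR_ge0. Qed.

Lemma coord_sqr_le x i : x 0 i ^+ 2 <= sqnormR x.
Proof.
rewrite /sqnormR /dotR (bigD1 i) //= expr2 lerDl.
by apply: sumr_ge0 => j _; exact: sqr_ge0.
Qed.

Lemma sqnormR_le x (b : R) : (forall i, `|x 0 i| <= b) -> sqnormR x <= d%:R * b ^+ 2.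
Proof.
move=> h; rewrite /sqnormR /dotR.
apply: (@le_trans _ _ (\sum_(i < d) b ^+ 2)).
  apply: ler_sum => i _; rewrite -expr2 -(real_normK (num_real (x 0 i))).
  by rewrite lerXn2r // nnegrE // (le_trans _ (h i)).
by rewrite sumr_const card_ord mulr_natl.
Qed.

End Dot.

Section HkNull.
Variables (R : realType) (d : nat).
Implicit Types (A : set 'rV[R]_d) (x : 'rV[R]_d).

(** The finite cover is completed by balls of radius 0, which cost nothing because [0 ^+ k = 0] for
    [0 < k]. *)
Lemma finite_cover_hk_null k A : (0 < k)%N ->
  (forall eps : R, 0 < eps -> exists (T : finType) (c : T -> 'rV[R]_d) (r : R),
    [/\ 0 <= r, forall x, A x -> exists t, sqnormR (x - c t) < r ^+ 2 &
        #|T|%:R * r ^+ k < eps]) -> hk_null k A.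
Proof.
move=> k0 h eps e0; have [T [c [r [r0 cov hr]]]] := h _ e0.
pose cc n := if insub n is Some i then c (enum_val (i : 'I_#|T|)) else 0.
pose rr n := if (n < #|T|)%N then r else 0.
exists cc, rr; split; first by move=> n; rewrite /rr; case: ifP.
split.
  move=> x /cov [t ht]; exists (enum_rank t) => //=.
  by rewrite /cc /rr ltn_ord valK enum_rankK.
rewrite (@nneseries_split _ _ 0 #|T|) //; last first.
  by move=> n _; rewrite lee_fin exprn_ge0 // /rr; case: ifP.
rewrite add0n [X in (_ + X)%E]eseries0 ?adde0; last first.
  by move=> n /= hn _; rewrite /rr ltnNge hn /= expr0n eqn0Ngt k0.
rewrite big_mkord sumEFin lte_fin.
under eq_bigr do rewrite /rr ltn_ord.
by rewrite sumr_const card_ord -mulr_natl.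
Qed.

(** If [k - 1] bounded coordinates determine the points of [A] in a Lipschitz way, then about
    [N ^ (k - 1)] balls of radius [C / N] cover [A], at a total cost of order [1 / N]. *)
Lemma lipschitz_coords_hk_null k A (l : 'I_k.-1 -> 'rV[R]_d -> R) (M C : R) : (0 < k)%N ->
  (forall x i, A x -> `|l i x| <= M) -> 0 <= C ->
  (forall x x' eta, A x -> A x' -> 0 < eta -> (forall i, `|l i x - l i x'| <= eta) ->
    sqnormR (x - x') < (C * eta) ^+ 2) -> hk_null k A.
Proof.
move=> k0 hM C0 hC; apply: finite_cover_hk_null => // eps e0.
pose m := (Num.truncn `|M|).+1.
have hm x i : A x -> `|l i x| <= m%:R.
  by move=> Ax; rewrite (le_trans (hM _ _ Ax)) // (le_trans (ler_norm _)) // ltW // truncnS_gt.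
(* There are [Q ^ (k - 1)] cells and [Q = 2 m N + 1 <= 3 m N], so the cost is at most [B / N], which
   the choice of [N] puts below [eps]. *)
pose B := (3 * m)%:R ^+ k.-1 * C ^+ k.
pose N := (Num.truncn (B / eps)).+1.
have N0 : 0 < N%:R :> R by rewrite ltr0n.
pose Q := (2 * m * N).+1.
pose T := {ffun 'I_k.-1 -> 'I_Q}.
pose cellof x : T := [ffun i => inord (Num.truncn ((l i x + m%:R) * N%:R))].
(* A representative in [A] of each cell, with default 0 for the cells that miss [A]. *)
pose c (t : T) : 'rV[R]_d := xget 0 [set x | A x /\ cellof x = t].
exists T, c, (C / N%:R); split.
- by rewrite divr_ge0.
- move=> x Ax; exists (cellof x).
  have [Ac Ec] : A (c (cellof x)) /\ cellof (c (cellof x)) = cellof x.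
    by apply: (@xgetPex _ 0 [set y | A y /\ cellof y = cellof x]); exists x.
  apply: hC => //; first by rewrite invr_gt0.
  move=> i; move: Ec => /ffunP /(_ i); rewrite !ffunE.
  set x' := c _ in Ac *.
  have hx y : A y -> 0 <= (l i y + m%:R) * N%:R /\
      (Num.truncn ((l i y + m%:R) * N%:R)%R < Q)%N.
    move=> Ay; have := hm y i Ay; rewrite ler_norml => /andP [h1 h2].
    have h0 : 0 <= (l i y + m%:R) * N%:R by rewrite mulr_ge0 // -lerBlDr sub0r.
    split=> //; rewrite ltnS -(@ler_nat R).
    apply: (@le_trans _ _ ((l i y + m%:R) * N%:R)); first by rewrite truncn_le.
    rewrite natrM ler_wpM2r // mul2n -addnn natrD lerD2r //.
  have [h0 hQ] := hx x Ax; have [h0' hQ'] := hx x' Ac.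
  move=> /(congr1 val); rewrite /= !inordK // => E.
  have := truncn_itv h0; have := truncn_itv h0'; rewrite E.
  set z : R := (Num.truncn _)%:R; rewrite -natr1 -/z => /andP [a1 a2] /andP [a3 a4].
  have : `|(l i x - l i x') * N%:R| <= 1.
    have -> : (l i x - l i x') * N%:R = (l i x + m%:R) * N%:R - (l i x' + m%:R) * N%:R by ring.
    rewrite ler_norml; apply/andP; split; lra.
  by rewrite normrM (ger0_norm (ltW N0)) -ler_pdivlMr // div1r.
- rewrite card_ffun !card_ord.
  apply: (@le_lt_trans _ _ (B / N%:R)); last first.
    by rewrite ltr_pdivrMr // mulrC -ltr_pdivrMr // truncnS_gt.
  rewrite /B natrX.
  have hQ : Q%:R <= (3 * m)%:R * N%:R :> R.
    by rewrite -natrM ler_nat /Q; lia.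
  have {}hQ : Q%:R ^+ k.-1 <= ((3 * m)%:R * N%:R) ^+ k.-1 :> R by rewrite lerXn2r ?nnegrE // -natrM.
  rewrite expr_div_n mulrA ler_pdivrMr ?exprn_gt0 //.
  have -> : (3 * m)%:R ^+ k.-1 * C ^+ k / N%:R * N%:R ^+ k =
      ((3 * m)%:R * N%:R) ^+ k.-1 * C ^+ k :> R.
    rewrite -{3}(prednK k0) exprS exprMn; field; exact: lt0r_neq0.
  by rewrite ler_wpM2r // exprn_ge0.
Qed.

End HkNull.

(** * Quadrics of a subspace and their regular pieces *)

Section Quad.
Variables (R : realType) (d : nat).
Implicit Types (x y Y : 'rV[R]_d) (c e : R).

Definition quad Y c e x : R := dotR x Y + c + e * sqnormR x.
Definition grad Y e x : 'rV[R]_d := Y + (2 * e) *: x.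

(** For a quadratic function the mean of the gradients at two points gives the exact increment.
    Between two zeros the right side is 0. *)
Lemma quad_grad Y c e x x' :
  dotR (x - x') (grad Y e x + grad Y e x') = 2 * (quad Y c e x - quad Y c e x').
Proof.
rewrite /quad /grad /sqnormR !(dotRDr, dotRDl, dotRZr, dotRNl) (dotRC x' x); ring.
Qed.

Lemma quadN Y c e x : quad (- Y) (- c) (- e) x = - quad Y c e x.
Proof. by rewrite /quad dotRNr; ring. Qed.

Lemma dotR_le x y (m : R) : (forall l, `|x 0 l| <= m) ->
  `|dotR x y| <= m * \sum_l `|y 0 l|.
Proof.
move=> hx; rewrite (le_trans (ler_norm_sum _ _ _)) // mulr_sumr.
by apply: ler_sum => l _; rewrite normrM ler_wpM2r.
Qed.

Lemma grad_le Y e x m l : `|x 0 l| <= m ->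
  `|grad Y e x 0 l| <= \sum_l `|Y 0 l| + 2 * `|e| * m.
Proof.
move=> hx; rewrite !mxE (le_trans (ler_normD _ _)) // lerD //.
  by rewrite (bigD1 l) //= lerDl sumr_ge0.
by rewrite !normrM (ger0_norm (_ : 0 <= 2)) // ler_wpM2l // mulr_ge0.
Qed.

Lemma scalar_le (f : {scalar 'rV[R]_d}) x (m : R) : (forall l, `|x 0 l| <= m) ->
  `|f x| <= m * \sum_l `|f (delta_mx 0 l)|.
Proof.
move=> hx; rewrite {1}[x]row_sum_delta linear_sum (le_trans (ler_norm_sum _ _ _)) //.
by rewrite mulr_sumr; apply: ler_sum => l _; rewrite linearZ normrM ler_wpM2r.
Qed.

Section Piece.
Variables (k : nat) (L : {vspace 'rV[R]_d}) (X : k.-tuple 'rV[R]_d).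
Hypothesis XL : basis_of L X.

(** For [Y] in [L], these countably many pieces exhaust the zeros in [L] at which the gradient is
    nonzero. *)
Definition quad_piece Y c e (j : 'I_k) (s : bool) (m : nat) : set 'rV[R]_d :=
  [set x | [/\ x \in L, quad Y c e x = 0, forall l, `|x 0 l| <= m%:R &
     m.+1%:R^-1 <= (-1) ^+ s * dotR (grad Y e x) X`_j ]].

(* The gradient has a component along [X`_j] bounded away from 0, so the piece is a
   Lipschitz graph over the coordinates other than the [j]-th. *)
Lemma quad_piece_hk_null Y c e j s m : hk_null k (quad_piece Y c e j s m).
Proof.
have k0 : (0 < k)%N by case: k j => [[]|].
set A := quad_piece _ _ _ _ _ _.
pose l (i : 'I_k.-1) x : R := coord X (lift j i) x.
pose M1 := \sum_i \sum_l `|coord X (lift j i) (delta_mx 0 l)|.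
pose gm := \sum_l `|Y 0 l| + 2 * `|e| * m%:R.
pose S := \sum_(i < k) \sum_l `|X`_i 0 l|.
have sle (i : 'I_k) : \sum_l `|X`_i 0 l| <= S.
  by rewrite /S [leRHS](bigD1 i) //= lerDl sumr_ge0 // => i' _; exact: sumr_ge0.
have S0 : 0 <= S by apply: sumr_ge0 => i _; exact: sumr_ge0.
have gm0 : 0 <= gm by rewrite addr_ge0 ?sumr_ge0 // !mulr_ge0.
(* [T * eta] will bound every coordinate of [x - x']: the 1 serves those other than [j], the second
   term is the bound [ajT] on the [j]-th. *)
pose T := 1 + k%:R * (gm * S) * m.+1%:R.
have T0 : 0 < T by rewrite ltr_pwDl // !mulr_ge0.
(* The [+ 1] in [d%:R + 1] and in [S + 1] makes the final inequality strict. *)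
apply: (@lipschitz_coords_hk_null R d k A l (m%:R * M1) ((d%:R + 1) * T * (S + 1))) => //.
- move=> x i [_ _ hx _]; rewrite (le_trans (scalar_le (coord X (lift j i)) hx)) //.
  by rewrite ler_wpM2l // /M1 [leRHS](bigD1 i) //= lerDl sumr_ge0 // => i' _; exact: sumr_ge0.
- apply: mulr_ge0; last by rewrite addr_ge0.
  by apply: mulr_ge0; [rewrite addr_ge0|exact: ltW].
move=> x x' eta [xL qx hx gx] [x'L qx' hx' gx'] eta0 hl.
pose a (i : 'I_k) := coord X i x - coord X i x'.
have xx' : x - x' = \sum_i a i *: X`_i.
  rewrite {1}(coord_basis XL xL) {1}(coord_basis XL x'L) -sumrB.
  by apply: eq_bigr => i _; rewrite scalerBl.
have E (i : 'I_k) : `|dotR X`_i (grad Y e x + grad Y e x')| <= 2 * (gm * S).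
  rewrite dotRDr (le_trans (ler_normD _ _)) // mulr_natl mulr2n !(dotRC X`_i).
  apply: lerD; rewrite (le_trans (dotR_le _ (m := gm) _)) //.
  - by move=> l'; apply: grad_le.
  - by rewrite ler_wpM2l.
  - by move=> l'; apply: grad_le.
  - by rewrite ler_wpM2l.
(* One linear equation in the [a i]. It can be solved for [a j], whose coefficient is at least
   [2 / m.+1] in absolute value because both gradients have the same sign along the [j]-th basis
   vector. *)
have H0 : \sum_i a i * dotR X`_i (grad Y e x + grad Y e x') = 0.
  have := quad_grad Y c e x x'; rewrite qx qx' subrr mulr0 xx' dotR_suml => H; rewrite -[RHS]H.
  by apply: eq_bigr => i _; rewrite dotRZl.
have aj i : i != j -> `|a i| <= eta.
  by case: (unliftP j i) => [i' ->|->]; rewrite ?eqxx // => _; exact: hl.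
have ajT : `|a j| <= k%:R * (gm * S) * m.+1%:R * eta.
  have hD : 2 * m.+1%:R^-1 <= `|dotR X`_j (grad Y e x + grad Y e x')|.
    have -> : `|dotR X`_j (grad Y e x + grad Y e x')| =
        `|(-1) ^+ s * dotR X`_j (grad Y e x + grad Y e x')|.
      by rewrite normrM normrX normrN1 expr1n mul1r.
    rewrite (le_trans _ (ler_norm _)) // dotRDr mulrDr mulr_natl mulr2n.
    by rewrite !(dotRC X`_j) lerD.
  have hj : `|a j| * `|dotR X`_j (grad Y e x + grad Y e x')| <= k%:R * eta * (2 * (gm * S)).
    rewrite -normrM; move: H0; rewrite (bigD1 j) //= => /eqP; rewrite addr_eq0 => /eqP ->.
    rewrite normrN (le_trans (ler_norm_sum _ _ _)) //.
    apply: (@le_trans _ _ (\sum_(i < k | i != j) eta * (2 * (gm * S)))).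
      by apply: ler_sum => i ij; rewrite normrM; apply: ler_pM => //; exact: aj.
    rewrite [leRHS](_ : _ = \sum_(i < k) eta * (2 * (gm * S))); last first.
      by rewrite sumr_const card_ord -[RHS]mulr_natl -mulrA.
    rewrite [leRHS](bigD1 j) //= lerDr !mulr_ge0 // ltW //.
  have m0 : 0 < m.+1%:R :> R by rewrite ltr0n.
  have : `|a j| * 2 / m.+1%:R <= k%:R * eta * (2 * (gm * S)).
    by rewrite -[leLHS]mulrA (le_trans _ hj) // ler_wpM2l.
  rewrite ler_pdivrMr // => h.
  have -> : k%:R * (gm * S) * m.+1%:R * eta = k%:R * eta * (2 * (gm * S)) * m.+1%:R / 2.
    by field.
  by rewrite ler_pdivlMr.
have aT i : `|a i| <= T * eta.
  have [->|ij] := eqVneq i j.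
    by rewrite (le_trans ajT) // ler_wpM2r ?(ltW eta0) // /T lerDr.
  by rewrite (le_trans (aj _ ij)) // ler_peMl ?(ltW eta0) // /T lerDl !mulr_ge0.
have bnd l' : `|(x - x') 0 l'| <= T * eta * S.
  rewrite xx' summxE (le_trans (ler_norm_sum _ _ _)) // /S mulr_sumr.
  apply: ler_sum => i _; rewrite mxE normrM; apply: ler_pM => //.
  by rewrite (bigD1 l') //= lerDl sumr_ge0.
apply: (le_lt_trans (sqnormR_le bnd)).
have : 0 < T * eta by rewrite mulr_gt0.
set t := T * eta => t0.
have -> : (d%:R + 1) * T * (S + 1) * eta = (d%:R + 1) * (t * (S + 1)) by rewrite /t; ring.
rewrite [ltRHS]exprMn.
apply: (@le_lt_trans _ _ (d%:R * (t * (S + 1)) ^+ 2)).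
  have tS : t * S <= t * (S + 1) by rewrite ler_wpM2l ?(ltW t0) // lerDl.
  have tS0 : 0 <= t * S by rewrite mulr_ge0 // ltW.
  by rewrite ler_wpM2l // lerXn2r // nnegrE // (le_trans tS0).
have tS1 : 0 < t * (S + 1) by rewrite mulr_gt0 // ltr_wpDl.
rewrite ltr_pM2r ?exprn_gt0 //.
have : 0 <= d%:R :> R by [].
by move: (d%:R : R) => D D0; nra.
Qed.

End Piece.
End Quad.

(** * Continuity and measurability *)

Section Borel.
Variables (R : realType) (d : nat).
Implicit Types (x Y : 'rV[R]_d) (A : set 'rV[R]_d).

Lemma open_measurable_rV A : open A -> measurable (A : set (borelR R d)).
Proof. by move=> oA; apply: sub_sigma_algebra. Qed.

Lemma closed_measurable_rV A : closed A -> measurable (A : set (borelR R d)).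
Proof.
move=> cA; rewrite -[A]setCK; apply: measurableC; apply: open_measurable_rV.
exact: closed_openC.
Qed.

Lemma coord_cont (l : 'I_d) : continuous (fun x => x 0 l).
Proof. exact: coord_continuous. Qed.

Lemma dotR_cont Y : continuous (fun x => dotR x Y).
Proof.
move=> x; apply: (@cvg_sumr R _ (nbhs x)) => i; apply: cvgM; last exact: cvg_cst.
exact: coord_cont.
Qed.

Lemma sqnormR_cont : continuous (fun x => sqnormR x).
Proof.
by move=> x; apply: (@cvg_sumr R _ (nbhs x)) => i; apply: cvgM; exact: coord_cont.
Qed.

Lemma quad_cont Y c e : continuous (quad Y c e).
Proof.
move=> x; apply: (@cvgD _ R^o _ (nbhs x)).
  by apply: (@cvgD _ R^o _ (nbhs x)); [exact: dotR_cont|exact: cvg_cst].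
by apply: (@cvgM _ _ (nbhs x)); [exact: cvg_cst|exact: sqnormR_cont].
Qed.

Lemma linear_coord_cont n (f : {linear 'rV[R]_d -> 'rV[R]_n}) (l : 'I_n) :
  continuous (fun x => f x 0 l).
Proof.
have -> : (fun x => f x 0 l) = (fun x => dotR x (\row_i f (delta_mx 0 i) 0 l)).
  apply/funext => x; rewrite {1}[x]row_sum_delta linear_sum summxE.
  by apply: eq_bigr => i _; rewrite linearZ !mxE.
exact: dotR_cont.
Qed.

Lemma closed_le_fun (f : 'rV[R]_d -> R) (b : R) : continuous f -> closed [set x | f x <= b].
Proof.
move=> cf; apply: (@closed_comp _ _ f [set y | y <= b]); last exact: closed_le.
by move=> x _; exact: cf.
Qed.

Lemma closed_ge_fun (f : 'rV[R]_d -> R) (b : R) : continuous f -> closed [set x | b <= f x].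
Proof.
move=> cf; apply: (@closed_comp _ _ f [set y | b <= y]); last exact: closed_ge.
by move=> x _; exact: cf.
Qed.

Lemma open_gt_fun (f : 'rV[R]_d -> R) (b : R) : continuous f -> open [set x | b < f x].
Proof.
move=> cf; apply: (@open_comp _ _ f [set y | b < y]); last exact: open_gt.
by move=> x _; exact: cf.
Qed.

Lemma measurable_cont_fun (f : 'rV[R]_d -> R) : continuous f ->
  measurable_fun setT (f : borelR R d -> R).
Proof.
move=> cf; apply: (measurability _ (RGenOpens.measurableE R)).
move=> _ [_ [a [b ->] <-]]; rewrite setTI; apply: open_measurable_rV.
by move/continuousP : cf; apply; exact: interval_open.
Qed.

Lemma subspace_closed (L : {vspace 'rV[R]_d}) : closed (sub_set L).
Proof.
have -> : sub_set L = [set x | \sum_l `|(x - projv L x) 0 l| <= 0].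
  apply/seteqP; split=> x; rewrite /sub_set /=.
    by move=> xL; rewrite projv_id // subrr big1 // => l _; rewrite mxE normr0.
  move=> h; have : \sum_l `|(x - projv L x) 0 l| == 0 by rewrite eq_le h sumr_ge0.
  rewrite psumr_eq0 // => /allP h0.
  have -> : x = projv L x.
    apply/rowP => l; apply/eqP; rewrite -subr_eq0 -normr_eq0.
    by have := h0 l (mem_index_enum l); rewrite /= !mxE.
  exact: memv_proj.
apply: closed_le_fun => x; apply: (@cvg_sumr R _ (nbhs x)) => l.
apply: cvg_norm.
have -> : (fun y => (y - projv L y) 0 l) = (fun y => y 0 l - (projv L y) 0 l).
  by apply/funext => y; rewrite !mxE.
rewrite (_ : (x - projv L x) 0 l = x 0 l - projv L x 0 l); last by rewrite !mxE.
by apply: cvgB; [exact: coord_cont|exact: linear_coord_cont].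
Qed.

End Borel.

(** * Quadrics are null *)

Section QuadNull.
Variables (R : realType) (d k : nat).
Hypothesis k_gt0 : (0 < k)%N.
Variables (L : {vspace 'rV[R]_d}) (mu : {measure set (borelR R d) -> \bar R}).
Hypotheses (dimL : \dim L = k) (muL : mass_distribution_on k L mu).

Let X := tcast dimL (vbasis L).
Let XL : basis_of L X.
Proof. by rewrite /X; case: _ / dimL; rewrite tcast_id; exact: vbasisP. Qed.

Lemma hk_null_negligible (A : set 'rV[R]_d) : closed A -> A `<=` sub_set L ->
  hk_null k A -> mu.-negligible (A : set (borelR R d)).
Proof.
have [_ [_ mu0]] := muL.
move=> cA AL hA; apply/negligibleP; first exact: closed_measurable_rV.
by apply: mu0 => //; exact: closed_measurable_rV.
Qed.

Lemma point_negligible (x : 'rV[R]_d) : x \in L ->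
  mu.-negligible ([set x] : set (borelR R d)).
Proof.
move=> xL; apply: hk_null_negligible.
- by apply: compact_closed; [exact: norm_hausdorff|exact: compact_set1].
- by move=> _ ->.
- apply: (@lipschitz_coords_hk_null R d k [set x] (fun _ _ => 0) 0 1) => //.
    by move=> *; rewrite normr0.
  move=> _ _ eta -> -> eta0 _; rewrite subrr /sqnormR dotR0l mul1r.
  by rewrite exprn_gt0.
Qed.

Lemma quad_piece_closed Y c e j s m : closed (@quad_piece R d k L X Y c e j s m).
Proof.
have -> : @quad_piece R d k L X Y c e j s m =
  sub_set L `&` ([set x | quad Y c e x <= 0] `&` [set x | 0 <= quad Y c e x]) `&`
  (\bigcap_(l in [set: 'I_d]) [set x : 'rV[R]_d | `|x 0 l| <= m%:R]) `&`
  [set x | m.+1%:R^-1 <= (-1) ^+ s * dotR (grad Y e x) X`_j].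
  apply/seteqP; split=> x.
    move=> [xL qx hx gx]; split=> //; split; last by move=> l _; exact: hx.
    by split=> //; split; rewrite /= qx.
  move=> [[[xL [q1 q2]] hx] gx]; split=> //.
    by apply/eqP; rewrite eq_le; apply/andP.
  by move=> l; exact: hx.
apply: closedI; last first.
  apply: closed_ge_fun => x; apply: (@cvgM _ _ (nbhs x)); first exact: cvg_cst.
  have -> : (fun z => dotR (grad Y e z) X`_j) = (fun z => dotR z ((2 * e) *: X`_j) + dotR Y X`_j).
    by apply/funext => z; rewrite /grad dotRDl dotRZl dotRZr addrC.
  rewrite (_ : dotR (grad Y e x) X`_j = dotR x ((2 * e) *: X`_j) + dotR Y X`_j); last first.
    by rewrite /grad dotRDl dotRZl dotRZr addrC.
  by apply: (@cvgD _ R^o _ (nbhs x)); [exact: dotR_cont|exact: cvg_cst].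
apply: closedI; last first.
  have cl (l : 'I_d) : closed [set x : 'rV[R]_d | `|x 0 l| <= m%:R].
    apply: (@closed_le_fun R d (fun x => `|x 0 l|)) => x.
    by apply: (@cvg_norm _ _ _ (nbhs x)); exact: coord_cont.
  by apply: closed_bigI => l _; exact: cl.
apply: closedI; first exact: subspace_closed.
by apply: closedI; [apply: closed_le_fun|apply: closed_ge_fun]; exact: quad_cont.
Qed.

(** Inside [L], which carries all the mass, a zero is either the critical point of the quadric or in
    one of countably many regular pieces, each null. *)
Lemma quad_null Y c e : Y \in L -> ~ [/\ Y = 0, c = 0 & e = 0] ->
  mu [set x : borelR R d | quad Y c e x = 0] = 0%E.
Proof.
move=> YL hnz; apply: measure_negligible.
  apply: (@closed_measurable_rV R d [set x | quad Y c e x = 0]).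
  rewrite (_ : mkset _ = [set x | quad Y c e x <= 0] `&` [set x | 0 <= quad Y c e x]).
    by apply: closedI; [apply: closed_le_fun|apply: closed_ge_fun]; exact: quad_cont.
  apply/seteqP; split=> x /=; first by move=> ->.
  by case=> h1 h2; apply/eqP; rewrite eq_le h1.
pose piece (z : 'I_k * bool * nat) : set (borelR R d) :=
  @quad_piece R d k L X Y c e z.1.1 z.1.2 z.2.
pose F n : set (borelR R d) := if unpickle n is Some z then piece z else set0.
have nF n : mu.-negligible (F n).
  rewrite /F; case: unpickle => [[[j s] m]|]; last exact: negligible_set0.
  apply: hk_null_negligible; [exact: quad_piece_closed|by move=> x []|].
  exact: quad_piece_hk_null.
(* The only zero of the gradient when [e != 0]; for [e = 0] it is the point 0, as [0^-1 = 0], and a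
   further null point is harmless. *)
pose x0 : 'rV[R]_d := - (2 * e)^-1 *: Y.
have nx0 : mu.-negligible ([set x0] : set (borelR R d)).
  by apply: point_negligible; rewrite memvZ.
have nL : mu.-negligible (~` (sub_set L : set (borelR R d))).
  have [_ [muL0 _]] := muL; apply/negligibleP => //; apply: measurableC.
  by apply: closed_measurable_rV; exact: subspace_closed.
apply: negligibleS (negligibleU nL (negligibleU nx0 (negligible_bigcup nF))) => x /= qx.
have [xL|xL] := boolP (x \in L); last by left; exact/negP.
right; have [g0|g0] := eqVneq (grad Y e x) 0.
  left; have [e0|e0] := eqVneq e 0.
    exfalso; apply: hnz; move: g0 qx; rewrite /grad /quad e0 mulr0 scale0r addr0 => -> /eqP.
    by rewrite dotRC dotR0l add0r mul0r addr0 => /eqP ->.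
  move/eqP: g0; rewrite /grad addrC addr_eq0 => /eqP h.
  rewrite /x0 scaleNr -scalerN -h scalerA mulVf ?scale1r // mulf_neq0 //.
right.
have gL : grad Y e x \in L by rewrite /grad memvD // memvZ.
(* A nonzero vector of [L] is not orthogonal to a whole basis of [L]. *)
have [j hj] : exists j : 'I_k, dotR (grad Y e x) X`_j != 0.
  apply: contrapT => /forallNP h; move: (sqnormR_gt0 g0).
  rewrite /sqnormR {1}(coord_basis XL gL) dotR_suml big1 ?ltxx // => i _.
  rewrite dotRZl dotRC; have := h i => /negP; rewrite negbK => /eqP ->.
  by rewrite mulr0.
pose a := `|dotR (grad Y e x) X`_j|.
have a0 : 0 < a by rewrite normr_gt0.
pose m := (Num.truncn a^-1 + Num.truncn (\sum_l `|x 0 l|) + 1)%N.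
pose s := dotR (grad Y e x) X`_j < 0.
exists (pickle (j, s, m)) => //; rewrite /F pickleK; split=> //=.
  move=> l; apply: (@le_trans _ _ (\sum_l `|x 0 l|)).
    by rewrite (bigD1 l) //= lerDl sumr_ge0.
  apply: (@le_trans _ _ (Num.truncn (\sum_l `|x 0 l|)).+1%:R); first by rewrite ltW // truncnS_gt.
  by rewrite ler_nat /m addn1 ltnS leq_addl.
have -> : (-1) ^+ s * dotR (grad Y e x) X`_j = a.
  rewrite /a /s; case: ltrP => h; first by rewrite mulN1r ltr0_norm.
  by rewrite mul1r ger0_norm.
rewrite -[leRHS]invrK lef_pV2 ?posrE ?invr_gt0 ?ltr0n //.
apply: (@le_trans _ _ (Num.truncn a^-1).+1%:R); first by rewrite ltW // truncnS_gt.
by rewrite ler_nat /m ltnS -addnA leq_addr.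
Qed.

End QuadNull.

(** * Lower semicontinuity of the imbalance *)

Section Cutoff.
Variables (R : realType) (d : nat).
Implicit Types (x Y : 'rV[R]_d) (c e : R) (n : nat).

Definition clamp01 (t : R) : R := Num.min 1 (Num.max 0 t).

Lemma clamp01_ge0 t : 0 <= clamp01 t.
Proof. by rewrite /clamp01 le_min ler01 le_max lexx. Qed.

Lemma clamp01_le1 t : clamp01 t <= 1.
Proof. by rewrite /clamp01 ge_min lexx. Qed.

Lemma clamp01_neq0 t : clamp01 t != 0 -> 0 < t.
Proof.
apply: contraR; rewrite -leNgt => t0.
by rewrite /clamp01 (max_l t0) min_r // ler01.
Qed.

Lemma clamp01_eq1 t : 1 <= t -> clamp01 t = 1.
Proof. by move=> t1; rewrite /clamp01 max_r ?min_l // (le_trans ler01). Qed.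

Lemma clamp01_cont (f : 'rV[R]_d -> R) : continuous f -> continuous (fun x => clamp01 (f x)).
Proof.
move=> cf x.
have c0 : {for x, continuous (fun=> 0 : R^o)} by exact: cst_continuous.
have c1 : {for x, continuous (fun=> 1 : R^o)} by exact: cst_continuous.
exact: (continuous_min c1 (continuous_max c0 (cf x))).
Qed.

(** Continuous approximations from below to the indicator of [0 < quad Y c e]. The second factor
    bounds the support, on which a small change of the coefficients moves [quad] uniformly
    little. *)
Definition cutoff Y c e n x : R :=
  clamp01 (n%:R * quad Y c e x - 1) * clamp01 (n%:R - sqnormR x).

Lemma cutoff_ge0 Y c e n x : 0 <= cutoff Y c e n x.
Proof. by rewrite mulr_ge0 // clamp01_ge0. Qed.

Lemma cutoff_le1 Y c e n x : cutoff Y c e n x <= 1.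
Proof. by rewrite mulr_ile1 // ?clamp01_ge0 // clamp01_le1. Qed.

Lemma cutoff_neq0 Y c e n x : cutoff Y c e n x != 0 ->
  1 < n%:R * quad Y c e x /\ sqnormR x < n%:R.
Proof.
by rewrite mulf_eq0 negb_or => /andP [/clamp01_neq0 + /clamp01_neq0]; rewrite !subr_gt0.
Qed.

Lemma cutoff_cont Y c e n : continuous (cutoff Y c e n).
Proof.
move=> x; apply: (@cvgM _ _ (nbhs x)).
  apply: (@clamp01_cont (fun x => n%:R * quad Y c e x - 1)) => {}x.
  apply: (@cvgB _ R^o _ (nbhs x)); last exact: cvg_cst.
  by apply: (@cvgM _ _ (nbhs x)); [exact: cvg_cst|exact: quad_cont].
apply: (@clamp01_cont (fun x => n%:R - sqnormR x)) => {}x.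
by apply: (@cvgB _ R^o _ (nbhs x)); [exact: cvg_cst|exact: sqnormR_cont].
Qed.

Definition poset Y c e : set (borelR R d) := [set x | 0 < quad Y c e x].

Lemma poset_measurable Y c e : measurable (poset Y c e).
Proof. by apply: open_measurable_rV; apply: open_gt_fun; exact: quad_cont. Qed.

(** Both clamps of [cutoff] equal 1 here, so the integral of the cutoff dominates the measure of
    this set. *)
Definition core Y c e n : set (borelR R d) :=
  [set x | 2 <= n%:R * quad Y c e x /\ sqnormR x + 1 <= n%:R].

Lemma core_measurable Y c e n : measurable (core Y c e n).
Proof.
apply: closed_measurable_rV.
rewrite (_ : core Y c e n =
  [set x | 2 <= n%:R * quad Y c e x] `&` [set x | sqnormR x + 1 <= n%:R]) //.
apply: closedI.
  apply: closed_ge_fun => x; apply: (@cvgM _ _ (nbhs x)); [exact: cvg_cst|exact: quad_cont].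
apply: closed_le_fun => x.
by apply: (@cvgD _ R^o _ (nbhs x)); [exact: sqnormR_cont|exact: cvg_cst].
Qed.

Lemma core_bigcup Y c e : \bigcup_n core Y c e n = poset Y c e.
Proof.
apply/seteqP; split=> x.
  case=> n _ [h _]; rewrite /poset /=.
  have n0 : 0 <= n%:R :> R by [].
  by rewrite ltNge; apply/negP => q0; nra.
rewrite /poset /= => q0.
exists (Num.truncn (2 / quad Y c e x) + Num.truncn (sqnormR x + 1) + 1)%N => //; split.
  rewrite -ler_pdivrMr //.
  apply: (@le_trans _ _ (Num.truncn (2 / quad Y c e x)).+1%:R).
    by rewrite ltW // truncnS_gt.
  by rewrite ler_nat addn1 ltnS leq_addr.
apply: (@le_trans _ _ (Num.truncn (sqnormR x + 1)).+1%:R).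
  by rewrite ltW // truncnS_gt.
by rewrite ler_nat addn1 ltnS leq_addl.
Qed.

Lemma core_homo Y c e : {homo core Y c e : n m / (n <= m)%N >-> (n <= m)%O}.
Proof.
move=> n m nm; apply/subsetPset => x [h1 h2].
have nmR : n%:R <= m%:R :> R by rewrite ler_nat.
have n0 : 0 <= n%:R :> R by [].
split; last by rewrite (le_trans h2).
rewrite (le_trans h1) // ler_wpM2r //.
by rewrite leNgt; apply/negP => q0; nra.
Qed.

Section Integrals.
Variable mu : {measure set (borelR R d) -> \bar R}.
Hypothesis mu_fin : (mu setT < +oo)%E.

Lemma measure_fin (A : set (borelR R d)) : measurable A -> mu A \is a fin_num.
Proof.
move=> mA; rewrite ge0_fin_numE //; apply: le_lt_trans mu_fin.
by apply: le_measure; rewrite ?inE.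
Qed.

Lemma cutoff_measurable Y c e n :
  measurable_fun setT (EFin \o (cutoff Y c e n : borelR R d -> R)).
Proof.
by apply/measurable_EFinP; apply: measurable_cont_fun; exact: cutoff_cont.
Qed.

Lemma indic_measurable (A : set (borelR R d)) : measurable A ->
  measurable_fun setT (EFin \o (\1_A : borelR R d -> R)).
Proof. by move=> mA; apply/measurable_EFinP; exact: measurable_indic. Qed.

Lemma int_cutoff_le (A : set (borelR R d)) Y c e n : measurable A ->
  (forall x, cutoff Y c e n x != 0 -> A x) ->
  (\int[mu]_(x in setT) (cutoff Y c e n x)%:E <= mu A)%E.
Proof.
move=> mA hA; rewrite -[A in leRHS]setIT -integral_indic //.
apply: ge0_le_integral => //.
- by move=> x _; rewrite lee_fin cutoff_ge0.
- exact: cutoff_measurable.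
- exact: indic_measurable.
move=> x _; rewrite lee_fin.
have [->|h] := eqVneq (cutoff Y c e n x) 0; first by rewrite indicE.
by rewrite indicE (mem_set (hA _ h)) cutoff_le1.
Qed.

Lemma int_cutoff_ge Y c e n :
  (mu (core Y c e n) <= \int[mu]_(x in setT) (cutoff Y c e n x)%:E)%E.
Proof.
rewrite -[core _ _ _ _ in leLHS]setIT -integral_indic //; last exact: core_measurable.
apply: ge0_le_integral => //.
- by apply: indic_measurable; exact: core_measurable.
- exact: cutoff_measurable.
move=> x _; rewrite lee_fin indicE; case: (boolP (x \in _)) => [|_]; last exact: cutoff_ge0.
rewrite inE => -[h1 h2]; rewrite /cutoff !clamp01_eq1 ?mulr1 //; lra.
Qed.

Lemma int_cutoff_fin Y c e n :
  (\int[mu]_(x in setT) (cutoff Y c e n x)%:E)%E \is a fin_num.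
Proof.
rewrite ge0_fin_numE; last by apply: integral_ge0 => x _; rewrite lee_fin cutoff_ge0.
by apply: le_lt_trans mu_fin; exact: int_cutoff_le.
Qed.

(** Continuity of the measure along the increasing sets [core], whose union is [poset Y c e]. *)
Lemma cutoff_approx Y c e eta : 0 < eta -> exists n,
  fine (mu (poset Y c e)) - eta < fine (\int[mu]_(x in setT) (cutoff Y c e n x)%:E).
Proof.
move=> eta0.
have cv : mu (core Y c e n) @[n --> \oo] --> (fine (mu (poset Y c e)))%:E.
  rewrite fineK; last by apply: measure_fin; exact: poset_measurable.
  rewrite -core_bigcup; apply: nondecreasing_cvg_mu.
  - by move=> n; exact: core_measurable.
  - by rewrite core_bigcup; exact: poset_measurable.
  - exact: core_homo.
have lt_a : fine (mu (poset Y c e)) - eta < fine (mu (poset Y c e)) by rewrite ltrBlDr ltrDl.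
have [n _ /(_ n (leqnn _)) /= hn] := cvgr_gt _ (fine_cvg cv) _ lt_a.
exists n; apply: (lt_le_trans hn); apply: fine_le.
- by apply: measure_fin; exact: core_measurable.
- exact: int_cutoff_fin.
- exact: int_cutoff_ge.
Qed.

End Integrals.

(** The linear terms are absorbed through [|x_l| <= |x|^2 + 1]. *)
Lemma quad_perturb Y c e Y' c' e' delta x : 0 <= delta ->
  (forall l, `|Y' 0 l - Y 0 l| <= delta) -> `|c' - c| <= delta -> `|e' - e| <= delta ->
  quad Y c e x - delta * ((d%:R + 1) * (sqnormR x + 1)) <= quad Y' c' e' x.
Proof.
move=> d0 hY hc he.
have -> : quad Y' c' e' x = quad Y c e x + (dotR x (Y' - Y) + (c' - c) + (e' - e) * sqnormR x).
  by rewrite /quad dotRBr; ring.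
rewrite lerD2l -[leLHS]opprK lerNl opprK.
apply: (le_trans (ler_norm _)); rewrite normrN.
have xs := sqnormR_ge0 x.
have h1 : `|dotR x (Y' - Y)| <= delta * (d%:R * (sqnormR x + 1)).
  rewrite dotRC (le_trans (dotR_le x (m := delta) _)) //.
    by move=> l; rewrite !mxE.
  rewrite ler_wpM2l //.
  apply: (@le_trans _ _ (\sum_(l < d) (sqnormR x + 1))).
    apply: ler_sum => l _; have := coord_sqr_le x l.
    rewrite -(real_normK (num_real (x 0 l))); have := normr_ge0 (x 0 l); nra.
  by rewrite sumr_const card_ord -[leLHS]mulr_natl.
have h2 : `|(e' - e) * sqnormR x| <= delta * sqnormR x.
  by rewrite normrM (ger0_norm xs) ler_wpM2r.
rewrite (le_trans (ler_normD _ _)) // (le_trans (lerD (ler_normD _ _) h2)) //.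
by have := lerD h1 hc; lra.
Qed.

End Cutoff.

Section LowerSemicontinuity.
Variables (R : realType) (d k : nat).
Variable mu : {vspace 'rV[R]_d} -> {measure set (borelR R d) -> \bar R}.
Hypothesis mu_assign : mass_assignment k mu.

Let mu_fin L : \dim L = k -> (mu L setT < +oo)%E.
Proof. by move=> dL; have [/(_ L dL) []] := mu_assign. Qed.

Definition imbalance L Y c e : R :=
  fine (mu L (poset Y c e)) - fine (mu L (poset (- Y) (- c) (- e))).

Lemma posetN_sub (Y : 'rV[R]_d) c e : poset (- Y) (- c) (- e) `<=` ~` poset Y c e.
Proof. by move=> x; rewrite /poset /= quadN oppr_gt0 => h; apply/negP; rewrite -leNgt ltW. Qed.

Lemma fine_measureC L (A : set (borelR R d)) : \dim L = k -> measurable A ->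
  fine (mu L (~` A)) = fine (mu L setT) - fine (mu L A).
Proof.
move=> dL mA; have fA := measure_fin (mu_fin dL).
rewrite -[setT](setUv A) measureU //; [|exact: measurableC|exact: setICr].
rewrite fineD ?fA //; [ring|exact: measurableC].
Qed.

(** The negative region lies in the complement of the positive one. This one-sided bound serves at
    the perturbed quadric, and [imbalance_eq] at the original one. *)
Lemma imbalance_ge L Y c e : \dim L = k ->
  2 * fine (mu L (poset Y c e)) - fine (mu L setT) <= imbalance L Y c e.
Proof.
move=> dL; have fA := measure_fin (mu_fin dL).
have : fine (mu L (poset (- Y) (- c) (- e))) <= fine (mu L (~` poset Y c e)).
  apply: fine_le; rewrite ?fA //; try exact: poset_measurable.
    by apply: measurableC; exact: poset_measurable.
  apply: le_measure; rewrite ?inE; [exact: poset_measurable| |exact: posetN_sub].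
  by apply: measurableC; exact: poset_measurable.
rewrite fine_measureC //; last exact: poset_measurable.
rewrite /imbalance; lra.
Qed.

(** The zero set is null by [quad_null]. The imbalance thus depends on the open positive region and
    the total mass only, and weak continuity controls these from the required sides. *)
Lemma imbalance_eq L Y c e : \dim L = k -> (0 < k)%N -> Y \in L ->
  ~ [/\ Y = 0, c = 0 & e = 0] ->
  imbalance L Y c e = 2 * fine (mu L (poset Y c e)) - fine (mu L setT).
Proof.
move=> dL k0 YL hnz; have fA := measure_fin (mu_fin dL).
have muL : mass_distribution_on k L (mu L) by have [/(_ L dL)] := mu_assign.
have h0 := quad_null k0 dL muL YL hnz.
have mP := @poset_measurable R d Y c e.
have mN := @poset_measurable R d (- Y) (- c) (- e).
have mZ : measurable ([set x | quad Y c e x = 0] : set (borelR R d)).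
  rewrite (_ : mkset _ = ~` (poset Y c e `|` poset (- Y) (- c) (- e))).
    by apply: measurableC; exact: measurableU.
  apply/seteqP; split=> x /=.
    by move=> q0 []; rewrite /poset /= ?quadN q0 ?oppr0 ltxx.
  move=> h; apply/eqP; rewrite eq_le !leNgt; apply/andP; split; apply/negP => q0; apply: h.
    by left.
  by right; rewrite /poset /= quadN oppr_gt0.
suff : fine (mu L (~` poset Y c e)) = fine (mu L (poset (- Y) (- c) (- e))).
  rewrite fine_measureC // /imbalance => <-; ring.
congr fine; rewrite (_ : ~` _ = poset (- Y) (- c) (- e) `|` [set x | quad Y c e x = 0]).
  rewrite measureU //; first by rewrite [X in (_ + X)%E](_ : _ = 0%E) ?adde0.
  apply/seteqP; split=> x //= -[]; rewrite /poset /= quadN => + q0.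
  by rewrite q0 oppr0 ltxx.
apply/seteqP; split=> x; rewrite /poset /= quadN.
  move/negP; rewrite -leNgt le_eqVlt => /orP [/eqP|] h; first by right.
  by left; rewrite oppr_gt0.
by case=> [h|->]; apply/negP; rewrite -leNgt // ltW // -oppr_gt0.
Qed.

(** A cutoff that captures nearly all the mass of the positive region is still supported in the
    positive region of any nearby quadric, and weak continuity nearly preserves its integral. *)
Lemma imbalance_lsc L P Y c e : (0 < k)%N -> \dim L = k -> is_orth_proj L P -> Y \in L ->
  ~ [/\ Y = 0, c = 0 & e = 0] -> 0 < imbalance L Y c e ->
  exists2 delta : R, 0 < delta & forall L' P' (Y' : 'rV[R]_d) c' e', \dim L' = k ->
    is_orth_proj L' P' ->
    (forall i j, `|P i j - P' i j| < delta) -> (forall l, `|Y' 0 l - Y 0 l| < delta) ->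
    `|c' - c| < delta -> `|e' - e| < delta -> 0 < imbalance L' Y' c' e'.
Proof.
move=> k0 dL LP YL hnz; rewrite imbalance_eq //; set a := fine (mu L (poset Y c e)).
set T := fine (mu L setT) => pos.
(* The passage to [L'] loses [2 * eta] on the positive region, counted twice, and [eta] on the total
   mass: in all [5 * eta] out of [2 * a - T = 8 * eta]. *)
pose eta := (2 * a - T) / 8.
have eta0 : 0 < eta by rewrite divr_gt0.
have [n hn] := cutoff_approx (mu_fin dL) Y c e eta0.
have [_ wc] := mu_assign.
have hb (f : 'rV[R]_d -> R) : continuous f -> (forall x, 0 <= f x <= 1) ->
   exists2 delta : R, 0 < delta &
   forall L' P', \dim L' = k -> is_orth_proj L' P' -> (forall i j, `|P i j - P' i j| < delta) ->
   `| fine (\int[mu L]_(x in setT) (f x)%:E) - fine (\int[mu L']_(x in setT) (f x)%:E) | < eta.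
  move=> cf bf; have [|delta d0 hd] := wc f cf _ L dL eta eta0.
    by exists 1 => x; have /andP [f0 f1] := bf x; rewrite ger0_norm.
  by exists delta => // L' P' dL' LP' hP; exact: hd LP LP' hP.
have [|d1 d10 h1] := hb (cutoff Y c e n) (@cutoff_cont _ _ _ _ _ _).
  by move=> x; rewrite cutoff_ge0 cutoff_le1.
(* The constant test function 1 controls the total mass. *)
have [||d2 d20 h2] := hb (fun=> 1); first exact: cst_continuous.
  by move=> x; rewrite ler01 lexx.
(* On the support of the cutoff, [quad] exceeds [1 / n] and [|x|^2 < n]; by [quad_perturb], changing
   the coefficients by [d3] costs less than [1 / n]. *)
pose d3 : R := (n%:R * ((d%:R + 1) * (n%:R + 1)) + 1)^-1.
have D0 : 0 <= n%:R * ((d%:R + 1) * (n%:R + 1)) :> R by rewrite !mulr_ge0 // addr_ge0.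
have d30 : 0 < d3 by rewrite invr_gt0 ltr_wpDl.
exists (Num.min d1 (Num.min d2 d3)); first by rewrite !lt_min d10 d20.
move=> L' P' Y' c' e' dL' LP' hP hY hc he.
have lt1 z : z < Num.min d1 (Num.min d2 d3) -> z < d1 by rewrite lt_min => /andP [].
have lt2 z : z < Num.min d1 (Num.min d2 d3) -> z < d2 by rewrite !lt_min => /and3P [].
have lt3 z : z < Num.min d1 (Num.min d2 d3) -> z <= d3.
  by rewrite !lt_min => /and3P [_ _ /ltW].
have {}h1 := h1 L' P' dL' LP' (fun i j => lt1 _ (hP i j)).
have {}h2 := h2 L' P' dL' LP' (fun i j => lt2 _ (hP i j)).
have int1 M : (\int[mu M]_(x in setT) (1 : R)%:E = mu M setT)%E.
  by rewrite integral_cst // mul1e.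
rewrite !int1 -/T in h2.
apply: lt_le_trans (imbalance_ge Y' c' e' dL').
have sub : (\int[mu L']_(x in setT) (cutoff Y c e n x)%:E <= mu L' (poset Y' c' e'))%E.
  apply: int_cutoff_le; first exact: poset_measurable.
  move=> x /cutoff_neq0 [q1 xn]; rewrite /poset /=.
  apply: lt_le_trans (quad_perturb x (ltW d30) (fun l => lt3 _ (hY l)) (lt3 _ hc) (lt3 _ he)).
  rewrite subr_gt0.
  have n0 : 0 < n%:R :> R by rewrite (le_lt_trans (sqnormR_ge0 x)).
  rewrite -(ltr_pM2l n0); apply: le_lt_trans q1.
  rewrite mulrCA /d3 -ler_pdivlMl ?invr_gt0 ?ltr_wpDl // invrK mulr1.
  rewrite (@le_trans _ _ (n%:R * ((d%:R + 1) * (n%:R + 1)))) ?lerDl //.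
  by rewrite ler_wpM2l // ler_wpM2l ?addr_ge0 // lerD2r ltW.
have := fine_le (int_cutoff_fin (mu_fin dL') _ _ _ _)
  (measure_fin (mu_fin dL') (@poset_measurable _ _ _ _ _)) sub.
move: h1 h2 hn pos; rewrite !ltr_distl /eta -/a; lra.
Qed.

End LowerSemicontinuity.

(** * Orthogonal projections *)

Section Proj.
Variables (R : realType) (d : nat).
Implicit Types (x y w : 'rV[R]_d) (U L : {vspace 'rV[R]_d}) (P : 'M[R]_d).

Lemma mul_outer x w : x *m (w^T *m w) = dotR x w *: w.
Proof.
rewrite mulmxA (_ : x *m w^T = (dotR x w)%:M) ?mul_scalar_mx //.
apply/matrixP => i j; rewrite !ord1 !mxE eqxx mulr1n.
by apply: eq_bigr => l _; rewrite mxE.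
Qed.

(** Adds the orthogonal projection onto the line of [w]; vectors are rows, so matrices act on the
    right. *)
Definition add_proj P w : 'M[R]_d := P + (sqnormR w)^-1 *: (w^T *m w).

Lemma mul_add_proj P w x : x *m add_proj P w = x *m P + ((sqnormR w)^-1 * dotR x w) *: w.
Proof. by rewrite mulmxDr -scalemxAr mul_outer scalerA. Qed.

(** Symmetry of [P] turns [w *m P = 0] into orthogonality of [w] to the image of [P]. *)
Lemma is_orth_proj_add U P w : is_orth_proj U P -> w != 0 -> w *m P = 0 ->
  is_orth_proj (U + <[w]>)%VS (add_proj P w).
Proof.
move=> [PT [PP UP]] w0 wP.
have nw : sqnormR w != 0 by rewrite sqnormR_eq0.
have Pw x : dotR (x *m P) w = 0.
  have : (x *m P) *m w^T = 0.
    by rewrite -mulmxA -PT -trmx_mul wP trmx0 mulmx0.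
  move/matrixP => /(_ 0 0); rewrite !mxE => h; rewrite -[RHS]h.
  by apply: eq_bigr => l _; rewrite [w^T _ _]mxE.
split; first by rewrite linearD /= linearZ /= trmx_mul trmxK PT.
split.
  apply/row_matrixP => i; rewrite row_mul !rowE.
  rewrite !mul_add_proj mulmxDl -!scalemxAl wP scaler0 addr0 -mulmxA PP; congr (_ + _ *: _).
  rewrite dotRDl dotRZl Pw add0r -[dotR w w]/(sqnormR w).
  by rewrite mulrAC mulVf // mul1r.
move=> x; split.
  case/memv_addP => u uU [_ /vlineP [a ->] ->].
  have uP : u *m P = u by apply/UP.
  rewrite mul_add_proj mulmxDl uP -scalemxAl wP scaler0 addr0; congr (_ + _ *: _).
  by rewrite dotRDl dotRZl -uP Pw add0r -[dotR w w]/(sqnormR w) mulrCA mulVf // mulr1.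
move=> h; rewrite -h mul_add_proj memv_add // ?memvZ ?memv_line //.
by apply/UP; rewrite -mulmxA PP.
Qed.

(** Gram-Schmidt: each new vector contributes its component [x - x *m P], if that is nonzero. *)
Lemma is_orth_proj_span (s : seq 'rV[R]_d) : exists P, is_orth_proj (span s) P.
Proof.
elim: s => [|x s [P sP]].
  exists 0; rewrite span_nil; split; first exact: trmx0.
  split; first exact: mul0mx.
  by move=> x; rewrite mulmx0 memv0; split => [/eqP ->|<-].
have [PT [PP UP]] := sP.
have xP : x *m P \in (span s) by apply/UP; rewrite -mulmxA PP.
have [w0|w0] := eqVneq (x - x *m P) 0.
  exists P; rewrite span_cons (_ : (_ + _)%VS = (span s)) //.
  apply/addv_idPr; rewrite -memvE; move/eqP: w0; rewrite subr_eq0 => /eqP ->.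
  exact: xP.
exists (add_proj P (x - x *m P)).
have -> : (span (x :: s)) = (span s + <[x - x *m P]>)%VS.
  apply/eqP; rewrite span_cons eqEsubv !subv_add addvSl -!memvE.
  have xin : x \in (span s + <[x - x *m P]>)%VS.
    by apply/memv_addP; exists (x *m P) => //; exists (x - x *m P); rewrite ?memv_line ?subrKC.
  rewrite xin addvSr /= memv_add ?memv_line //.
  by rewrite memvN.
apply: is_orth_proj_add => //.
by rewrite mulmxBl -mulmxA PP subrr.
Qed.

Lemma exists_orth_proj U : exists P, is_orth_proj U P.
Proof.
by have [P hP] := is_orth_proj_span (vbasis U); exists P; rewrite -(span_basis (vbasisP U)).
Qed.

Lemma dim_fullv_rV : \dim {: 'rV[R]_d} = d.
Proof. by rewrite dimvf /dim /= mul1n. Qed.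

Lemma dim_add_line U w : w \notin U -> \dim (U + <[w]>) = (\dim U).+1.
Proof.
move=> wU; have w0 : w != 0 by apply: contraNneq wU => ->; rewrite mem0v.
rewrite dimv_disjoint_sum ?dim_vline ?w0 ?addn1 //.
apply/eqP; rewrite -subv0; apply/subvP => x /memv_capP [xU /vlineP [a xa]].
move: xU; rewrite xa; have [->|a0] := eqVneq a 0; first by move=> _; rewrite scale0r mem0v.
move=> /(memvZ a^-1); rewrite scalerA mulVf // scale1r => w_in.
by rewrite w_in in wU.
Qed.

Lemma extend_subspace U n : (\dim U <= n <= d)%N ->
  exists2 U' : {vspace 'rV[R]_d}, (U <= U')%VS & \dim U' = n.
Proof.
elim: n => [|n IH] /andP [Un nd].
  by exists U => //; apply/eqP; rewrite -leqn0.
move: Un; rewrite leq_eqVlt => /orP [/eqP Un|]; first by exists U.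
rewrite ltnS => Un; have [|U' UU' dU'] := IH; first by rewrite Un ltnW.
have [w wU'] : exists w, w \notin U'.
  apply: contrapT => /forallNP h.
  have /dimvS : (fullv <= U')%VS by apply/subvP => w _; have := h w => /negP; rewrite negbK.
  by rewrite dim_fullv_rV dU' leqNgt nd.
exists (U' + <[w]>)%VS; first by rewrite (subv_trans UU') // addvSl.
by rewrite dim_add_line // dU'.
Qed.

(** The orthogonal complement of the image of [P], for [P] an orthogonal projection. *)
Definition orthv P : {vspace 'rV[R]_d} := lker (linfun (mulmxr P)).

Lemma mem_orthv P x : (x \in orthv P) = (x *m P == 0).
Proof. by rewrite memv_ker lfunE. Qed.

Lemma dim_orthv U P : is_orth_proj U P -> (\dim U + \dim (orthv P) = d)%N.
Proof.
move=> [_ [PP UP]].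
have := limg_ker_dim (linfun (mulmxr P) : 'Hom('rV[R]_d, 'rV[R]_d)) fullv.
rewrite capfv dim_fullv_rV addnC.
suff -> : limg (linfun (mulmxr P) : 'Hom('rV[R]_d, 'rV[R]_d)) = U by [].
apply/vspaceP => x; apply/idP/idP.
  by case/memv_imgP => y _ ->; rewrite lfunE; apply/UP; rewrite /= -mulmxA PP.
by move=> /UP xP; rewrite -xP; apply/memv_imgP; exists x; rewrite ?memvf // lfunE.
Qed.

End Proj.

(** * Parametrization of subspaces and quadrics *)

Lemma nbhs_rV_coord (R : realType) n (v : 'rV[R]_n) (A : set 'rV[R]_n) : nbhs v A ->
  exists2 delta : R, 0 < delta &
    forall v' : 'rV[R]_n, (forall l, `|v' 0 l - v 0 l| < delta) -> A v'.
Proof.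
move/nbhs_ballP => [e /= e0 he]; exists e => // v' hv'; apply: he; split=> // i j.
by rewrite ord1 /ball /= distrC.
Qed.

Section Param.
Variables (R : realType) (d k p : nat).
Variables (U : {vspace 'rV[R]_d}) (P : 'M[R]_d).
Variables (a : k.-1.-tuple 'rV[R]_d) (g : p.+1.-tuple 'rV[R]_d).
Implicit Types (v : 'rV[R]_p.+1) (y : 'rV[R]_k.+2).

(** The map [w] of the overview, when [g] is a basis of the orthogonal complement of [U]. *)
Definition dirv v : 'rV[R]_d := \sum_i v 0 i *: g`_i.
Definition spacev v : {vspace 'rV[R]_d} := (U + <[dirv v]>)%VS.
(* [y] lists the coefficients [c, e, a_1, .., a_(k-1), b] of the quadric
   [<a, x> + b <dirv v, x> + c + e |x|^2]. *)
Definition cst_of y : R := y 0 (inord 0).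
Definition sq_of y : R := y 0 (inord 1).
Definition lin_of v y : 'rV[R]_d :=
  \sum_(i < k.-1) y 0 (inord i.+2) *: a`_i + y 0 ord_max *: dirv v.

Lemma dirvN v : dirv (- v) = - dirv v.
Proof. by rewrite -sumrN; apply: eq_bigr => i _; rewrite mxE scaleNr. Qed.

Lemma lin_ofN v y : lin_of v (- y) = - lin_of v y.
Proof.
rewrite /lin_of opprD -sumrN mxE scaleNr; congr (_ + _).
by apply: eq_bigr => i _; rewrite mxE scaleNr.
Qed.

Lemma spacevN v : spacev (- v) = spacev v.
Proof.
rewrite /spacev dirvN; congr (_ + _)%VS; apply/eqP.
by rewrite eqEsubv -!memvE memvN memv_line -[X in X \in _]opprK memvN memv_line.
Qed.

Lemma flip_max_lt y (i : nat) : (i <= k)%N -> flip_max y 0 (inord i) = y 0 (inord i).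
Proof.
move=> ik; rewrite mxE; case: eqP => // /(congr1 val); rewrite /= inordK; lia.
Qed.

(** The last coefficient and the vector that it multiplies both change sign. *)
Lemma lin_of_flip v y : lin_of (- v) (flip_max y) = lin_of v y.
Proof.
rewrite /lin_of dirvN [flip_max y 0 ord_max]mxE eqxx scalerN scaleNr opprK.
congr (_ + _); apply: eq_bigr => i _; rewrite flip_max_lt //.
by have := ltn_ord i; lia.
Qed.

Hypothesis k_gt0 : (0 < k)%N.
Hypothesis UP : is_orth_proj U P.
Hypotheses (Ua : basis_of U a) (Wg : basis_of (orthv P) g).

Lemma dirv_orth v : dirv v \in orthv P.
Proof.
by apply: rpred_sum => i _; rewrite memvZ // (basis_mem Wg) // mem_nth // size_tuple.
Qed.

Lemma dirv_mulP v : dirv v *m P = 0.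
Proof. by apply/eqP; rewrite -mem_orthv dirv_orth. Qed.

Lemma dirv_neq0 v : v != 0 -> dirv v != 0.
Proof.
apply: contra_neq => h; apply/rowP => i; rewrite mxE.
exact: (freeP (basis_free Wg) (fun i => v 0 i) h i).
Qed.

Lemma orth_cap x : x \in U -> x \in orthv P -> x = 0.
Proof.
by have [_ [_ h]] := UP; rewrite mem_orthv => /h xP /eqP xP0; rewrite -xP xP0.
Qed.

Lemma dim_spacev v : v != 0 -> \dim (spacev v) = k.
Proof.
move=> v0; rewrite dim_add_line; first by rewrite (size_basis Ua) prednK.
apply/negP => h; have := dirv_neq0 v0.
by rewrite (orth_cap h (dirv_orth v)) eqxx.
Qed.

Lemma spacev_proj v : v != 0 -> is_orth_proj (spacev v) (add_proj P (dirv v)).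
Proof. by move=> v0; apply: is_orth_proj_add => //; [exact: dirv_neq0|exact: dirv_mulP]. Qed.

Lemma lin_of_in v y : lin_of v y \in spacev v.
Proof.
rewrite memv_add ?memvZ ?memv_line //; apply: rpred_sum => i _.
by rewrite memvZ // (basis_mem Ua) // mem_nth // size_tuple.
Qed.

(** The basis [a] of [U] and the nonzero vector [dirv v] orthogonal to [U] are independent, so
    [lin_of v y = 0] kills all the linear coefficients in [y]. *)
Lemma param_nondeg v y : v != 0 -> y != 0 ->
  ~ [/\ lin_of v y = 0, cst_of y = 0 & sq_of y = 0].
Proof.
move=> v0 y0 [Y0 c0 e0]; case/eqP: y0.
have [ym hm] : y 0 ord_max = 0 /\ forall i : 'I_k.-1, y 0 (inord i.+2) = 0.
  have aU : \sum_(i < k.-1) y 0 (inord i.+2) *: a`_i \in U.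
    by apply: rpred_sum => i _; rewrite memvZ // (basis_mem Ua) // mem_nth // size_tuple.
  move/eqP: Y0; rewrite /lin_of addr_eq0 => /eqP E.
  have s0 : \sum_(i < k.-1) y 0 (inord i.+2) *: a`_i = 0.
    by apply: orth_cap => //; rewrite E -scaleNr memvZ ?dirv_orth.
  split; last exact: (freeP (basis_free Ua) (fun i => y 0 (inord i.+2)) s0).
  move/eqP: E; rewrite s0 eq_sym oppr_eq0 scaler_eq0 (negbTE (dirv_neq0 v0)) orbF.
  by move/eqP.
apply/rowP => l; rewrite mxE.
have [l0|l0] := eqVneq (val l) 0%N.
  by rewrite -[l]inord_val l0.
have [l1|l1] := eqVneq (val l) 1%N.
  by rewrite -[l]inord_val l1.
have [lm|lm] := eqVneq (val l) k.+1.
  by rewrite (_ : l = ord_max) //; apply: val_inj.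
have ll := ltn_ord l; have lk : ((val l).-2 < k.-1)%N by move: l0 l1 lm ll => /=; lia.
have := hm (Ordinal lk); rewrite (_ : inord _ = l) //; apply: val_inj.
rewrite /= inordK; move: l0 l1 lm ll lk => /=; lia.
Qed.

(** All the data are rational in [v] and [y], and the only denominator, [sqnormR (dirv v)], is
    nonzero. *)
Lemma param_near v y (e0 : R) : v != 0 -> 0 < e0 -> exists2 delta : R, 0 < delta &
  forall (v' : 'rV[R]_p.+1) (y' : 'rV[R]_k.+2),
    (forall l, `|v' 0 l - v 0 l| < delta) -> (forall l, `|y' 0 l - y 0 l| < delta) ->
    [/\ forall i j, `|add_proj P (dirv v) i j - add_proj P (dirv v') i j| < e0,
        forall l, `|lin_of v' y' 0 l - lin_of v y 0 l| < e0,
        `|cst_of y' - cst_of y| < e0 & `|sq_of y' - sq_of y| < e0].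
Proof.
move=> v0 e00.
pose Z : Type := ('rV[R]_p.+1 * 'rV[R]_k.+2)%type.
pose N := nbhs ((v, y) : 'rV[R]_p.+1 * 'rV[R]_k.+2).
have FN : Filter N by exact: nbhs_filter.
have near_lt (f : 'rV[R]_p.+1 * 'rV[R]_k.+2 -> R) : f z @[z --> N] --> f (v, y) ->
    N [set z | `|f (v, y) - f z| < e0].
  by move=> /cvgrPdist_lt; apply.
have cv i : (z.1 : 'rV[R]_p.+1) 0 i @[z --> N] --> v 0 i.
  apply: (@cvg_comp _ _ _ fst (fun w : 'rV[R]_p.+1 => w 0 i) N (nbhs v)); first exact: cvg_fst.
  exact: coord_continuous.
have cy i : (z.2 : 'rV[R]_k.+2) 0 i @[z --> N] --> y 0 i.
  apply: (@cvg_comp _ _ _ snd (fun w : 'rV[R]_k.+2 => w 0 i) N (nbhs y)); first exact: cvg_snd.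
  exact: coord_continuous.
have cdir l : dirv z.1 0 l @[z --> N] --> dirv v 0 l.
  have dE w : dirv w 0 l = \sum_i w 0 i * g`_i 0 l.
    by rewrite summxE; apply: eq_bigr => i _; rewrite mxE.
  rewrite dE (_ : (fun z : Z => dirv z.1 0 l) = (fun z : Z => \sum_i z.1 0 i * g`_i 0 l)).
    by apply: cvg_sumr => i; apply: cvgM; [exact: cv|exact: cvg_cst].
  by apply/funext => z; rewrite dE.
have cnorm : sqnormR (dirv z.1) @[z --> N] --> sqnormR (dirv v).
  by apply: cvg_sumr => l; apply: cvgM; exact: cdir.
have cP i j : add_proj P (dirv z.1) i j @[z --> N] --> add_proj P (dirv v) i j.
  have pE w : add_proj P (dirv w) i j =
      P i j + (sqnormR (dirv w))^-1 * (dirv w 0 i * dirv w 0 j).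
    by rewrite !mxE big_ord1 !mxE.
  rewrite pE (_ : (fun z : Z => add_proj P (dirv z.1) i j) = (fun z : Z =>
    P i j + (sqnormR (dirv z.1))^-1 * (dirv z.1 0 i * dirv z.1 0 j))); last first.
    by apply/funext => z; rewrite pE.
  apply: cvgD; first exact: cvg_cst.
  apply: cvgM; last by apply: cvgM; exact: cdir.
  by apply: cvgV => //; rewrite sqnormR_eq0 dirv_neq0.
have cY l : lin_of z.1 z.2 0 l @[z --> N] --> lin_of v y 0 l.
  have lE w x : lin_of w x 0 l =
      \sum_(i < k.-1) x 0 (inord i.+2) * a`_i 0 l + x 0 ord_max * dirv w 0 l.
    rewrite /lin_of mxE summxE [in LHS]mxE; congr (_ + _).
    by apply: eq_bigr => i _; rewrite mxE.
  rewrite lE (_ : (fun z : Z => lin_of z.1 z.2 0 l) = (fun z : Z =>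
    \sum_(i < k.-1) z.2 0 (inord i.+2) * a`_i 0 l + z.2 0 ord_max * dirv z.1 0 l)); last first.
    by apply/funext => z; rewrite lE.
  apply: cvgD; last by apply: cvgM; [exact: cy|exact: cdir].
  by apply: cvg_sumr => i; apply: cvgM; [exact: cy|exact: cvg_cst].
have nP : N [set z | forall i j, `|add_proj P (dirv v) i j - add_proj P (dirv z.1) i j| < e0].
  apply: (@filter_forall _ _ (fun i z => forall j,
    `|add_proj P (dirv v) i j - add_proj P (dirv z.1) i j| < e0) N FN) => i.
  apply: (@filter_forall _ _ (fun j z =>
    `|add_proj P (dirv v) i j - add_proj P (dirv z.1) i j| < e0) N FN) => j.
  exact: (near_lt (fun z => add_proj P (dirv z.1) i j)).
have nY : N [set z | forall l, `|lin_of v y 0 l - lin_of z.1 z.2 0 l| < e0].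
  apply: (@filter_forall _ _ (fun l z =>
    `|lin_of v y 0 l - lin_of z.1 z.2 0 l| < e0) N FN) => l.
  exact: (near_lt (fun z => lin_of z.1 z.2 0 l)).
have nc := near_lt (fun z => cst_of z.2) (cy _).
have ne := near_lt (fun z => sq_of z.2) (cy _).
have [[A B] /= [/nbhs_rV_coord [d1 d10 h1] /nbhs_rV_coord [d2 d20 h2]] hAB] :=
  filterI (filterI nP nY) (filterI nc ne).
exists (Num.min d1 d2); first by rewrite lt_min d10.
move=> v' y' hv hy.
have [] := hAB (v', y').
  split; [apply: h1 => l; have := hv l|apply: h2 => l; have := hy l];
    by rewrite lt_min => /andP [].
move=> [/= hP hY] [/= hc he]; split=> //; last 2 first.
- by rewrite distrC.
- by rewrite distrC.
by move=> l; rewrite distrC.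
Qed.

End Param.

(** * Bisecting regions *)

Section Region.
Variables (R : realType) (d k : nat).
Hypothesis k_gt0 : (0 < k)%N.
Variables (L : {vspace 'rV[R]_d}) (Y : 'rV[R]_d) (c e : R).
Hypotheses (dimL : \dim L = k) (YL : Y \in L) (Yce : ~ [/\ Y = 0, c = 0 & e = 0]).

Section OneMass.
Variable mu : {vspace 'rV[R]_d} -> {measure set (borelR R d) -> \bar R}.
Hypotheses (mu_assign : mass_assignment k mu) (bal : imbalance mu L Y c e = 0).

Let mu_fin : (mu L setT < +oo)%E.
Proof. by have [/(_ L dimL) []] := mu_assign. Qed.

Lemma balanced_region_half : (mu L [set x | x \in L /\ (quad Y c e x <= 0)%R] * 2%:E = mu L setT)%E.
Proof.
have mP := @poset_measurable R d Y c e.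
have mL : measurable (sub_set L : set (borelR R d)).
  by apply: closed_measurable_rV; exact: subspace_closed.
have mCP : measurable (~` poset Y c e) by exact: measurableC.
have L0 : mu L (~` (sub_set L : set (borelR R d))) = 0%E.
  by have [/(_ L dimL) [_ []]] := mu_assign.
have -> : mu L [set x | x \in L /\ quad Y c e x <= 0] = mu L (~` poset Y c e).
  rewrite (measureDI (mu L) mCP mL).
  rewrite [X in _ = (X + _)%E](_ : _ = 0%E); last first.
    apply/eqP; rewrite -measure_le0 -L0; apply: le_measure; rewrite ?inE.
    - exact: measurableD.
    - exact: measurableC.
    - by move=> x [].
  rewrite add0e; congr (mu L _); apply/seteqP; split=> x; rewrite /poset /sub_set /=.
    by case=> xL q0; split=> //; apply/negP; rewrite -leNgt.
  by case=> /negP; rewrite -leNgt.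
have f1 := measure_fin mu_fin mCP; have f2 := measure_fin mu_fin measurableT.
rewrite -(fineK f1) -(fineK f2) -EFinM; congr (_%:E).
rewrite (fine_measureC mu_assign dimL mP).
by have := bal; rewrite (imbalance_eq mu_assign dimL) //; lra.
Qed.

(** One of the two open regions is empty, so balance forces the total mass to be 0, and then any
    region halves it. *)
Lemma balanced_empty_null (B : set (borelR R d)) : measurable B ->
  (forall x, quad Y c e x <= 0) \/ (forall x, 0 <= quad Y c e x) ->
  (mu L B * 2%:E = mu L setT)%E.
Proof.
move=> mB hempty.
suff T0 : mu L setT = 0%E.
  have B0 : mu L B = 0%E.
    by apply/eqP; rewrite -measure_le0 -T0; apply: le_measure; rewrite ?inE.
  by rewrite B0 T0 mul0e.
have f2 := measure_fin mu_fin measurableT.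
rewrite -(fineK f2); congr (_%:E).
have p0 : fine (mu L (poset Y c e)) = 0.
  have set0E Y' c' e' : (forall x, quad Y' c' e' x <= 0) -> poset Y' c' e' = set0 :> set 'rV[R]_d.
    move=> h; apply/seteqP; split=> x //; rewrite /poset /= => q0.
    by have := h x; rewrite leNgt q0.
  case: hempty => h; first by rewrite (set0E _ _ _ h) measure0.
  have := bal; rewrite /imbalance (set0E (- Y) (- c) (- e)) ?measure0 ?subr0 // => x.
  by rewrite quadN oppr_le0.
by have := bal; rewrite (imbalance_eq mu_assign dimL) // p0; lra.
Qed.

End OneMass.

Lemma quad_center x : e != 0 -> quad Y c e x =
  e * (sqnormR (x - (- (2 * e)^-1 *: Y)) - (sqnormR ((2 * e)^-1 *: Y) - c / e)).
Proof.
move=> e0; rewrite /quad /sqnormR scaleNr opprK.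
rewrite !(dotRDl, dotRDr, dotRZl, dotRZr) (dotRC Y x); field.
by rewrite e0.
Qed.

(** By completing the square, [quad <= 0] is a ball for [0 < e]; for [e = 0] it is a half-space. In
    the degenerate cases [quad] has a constant weak sign, and any ball will do. *)
Lemma balanced_region I (mu : I -> {vspace 'rV[R]_d} -> {measure set (borelR R d) -> \bar R}) :
  (forall i, mass_assignment k (mu i)) -> (forall i, imbalance (mu i) L Y c e = 0) -> 0 <= e ->
  exists B : set 'rV[R]_d, sphere_region L B /\
    forall i, (mu i L (B : set (borelR R d)) * 2%:E = mu i L setT)%E.
Proof.
move=> hmu bal e_ge0.
have null_case : (forall x, quad Y c e x <= 0) \/ (forall x, 0 <= quad Y c e x) ->
    exists B : set 'rV[R]_d, sphere_region L B /\
    forall i, (mu i L (B : set (borelR R d)) * 2%:E = mu i L setT)%E.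
  move=> h; exists (closed_ball_in L 0 1); split.
    by left; exists 0, 1; rewrite mem0v ltr01.
  move=> i; apply: (balanced_empty_null (hmu i) (bal i)) => //.
  apply: (@closed_measurable_rV R d (closed_ball_in L 0 1)).
  rewrite (_ : closed_ball_in L 0 1 = sub_set L `&` [set x | sqnormR x <= 1 ^+ 2]).
    by apply: closedI; [exact: subspace_closed|apply: closed_le_fun; exact: sqnormR_cont].
  by apply/seteqP; split=> x; rewrite /closed_ball_in /sub_set /= subr0.
have [e0|e0] := eqVneq e 0.
  have [Y0|Y0] := eqVneq Y 0.
    have qc x : quad Y c e x = c by rewrite /quad e0 Y0 dotRC dotR0l add0r mul0r addr0.
    by apply: null_case; case: (lerP c 0) => hc; [left|right] => x; rewrite qc // ltW.
  exists (closed_halfspace_in L Y (- c)); split; first by right; exists Y, (- c).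
  move=> i; rewrite -(balanced_region_half (hmu i) (bal i)); congr (mu i L _ * _)%E.
  have q0 x : quad Y c e x = dotR x Y + c by rewrite /quad e0 mul0r addr0.
  by apply/seteqP; split=> x [xL h]; split=> //; move: h; rewrite q0 -lerBrDr sub0r.
have ep : 0 < e by rewrite lt_def e0.
have := quad_center _ e0; set x0 := - _ *: Y; set rho := _ - c / e => qE.
have [rho0|rho0] := lerP rho 0.
  apply: null_case; right => x; rewrite qE mulr_ge0 // subr_ge0.
  by rewrite (le_trans rho0) // sqnormR_ge0.
exists (closed_ball_in L x0 (Num.sqrt rho)); split.
  by left; exists x0, (Num.sqrt rho); rewrite sqrtr_gt0 memvZ.
move=> i; rewrite -(balanced_region_half (hmu i) (bal i)); congr (mu i L _ * _)%E.
by apply/seteqP; split=> x [xL h]; split=> //; move: h;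
  rewrite qE pmulr_rle0 // subr_le0 sqr_sqrtr // ltW.
Qed.

End Region.

(** * Simultaneous bisection of mass assignments *)

Unset Implicit Arguments.

Theorem theorem1p2 (R : realType) (d k : nat) (hk1 : (1 <= k)%N) (hkd : (k <= d)%N)
    (u : 'I_k.-1 -> 'rV[R]_d)
    (mu : 'I_d.+1 -> {vspace 'rV[R]_d} -> {measure set borelR R d -> \bar R})
    (hmu : forall i, mass_assignment k (mu i)) :
  exists (L : {vspace 'rV[R]_d}) (B : set 'rV[R]_d),
    [/\ \dim L = k, (forall j, u j \in L), sphere_region L B &
        forall i, (mu i L (B : set (borelR R d)) * 2%:E = mu i L setT)%E].
Proof.
pose s := [seq u j | j <- enum 'I_k.-1].
(* The [u j] may be dependent; their span is enlarged to dimension exactly [k - 1], so that one more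
   direction gives [L]. *)
have [|U sU dU] := @extend_subspace R d (span s) k.-1.
  have ss : size s = k.-1 by rewrite size_map size_enum_ord.
  by rewrite -{1}ss dim_span (leq_trans (leq_pred k)).
have [P UP] := exists_orth_proj U.
pose p := (d - k)%N.
have dW : \dim (orthv P) = p.+1 by have := dim_orthv UP; rewrite dU /p; lia.
have [a Ua] : exists a : k.-1.-tuple 'rV[R]_d, basis_of U a.
  by rewrite -dU; exists (vbasis U); exact: vbasisP.
have [g Wg] : exists g : p.+1.-tuple 'rV[R]_d, basis_of (orthv P) g.
  by rewrite -dW; exists (vbasis (orthv P)); exact: vbasisP.
(* With [q = k + 1], there are as many functions in [twisted_borsuk_ulam] as masses. *)
have pq : (p + k.+1 = d.+1)%N by rewrite /p; lia.
pose F (j : 'I_(p + k.+1)) (v : 'rV[R]_p.+1) (y : 'rV[R]_k.+2) :=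
  imbalance (mu (cast_ord pq j)) (spacev U g v) (lin_of a g v y) (cst_of y) (sq_of y).
have [||| v [y [v0 y0 hF]]] := @twisted_borsuk_ulam R p k.+1 (ltn0Sn k) F.
- move=> j v y v0 y0; rewrite /F lin_ofN /cst_of /sq_of !mxE /imbalance !opprK; ring.
- move=> j v y v0 y0; rewrite /F spacevN lin_of_flip /cst_of /sq_of !flip_max_lt //.
- move=> j v y v0 y0 Fp.
  have [e1 e10 h1] := imbalance_lsc (hmu (cast_ord pq j)) hk1 (dim_spacev hk1 UP Ua Wg v0)
    (spacev_proj UP Wg v0) (lin_of_in g Ua v y) (param_nondeg hk1 UP Ua Wg v0 y0) Fp.
  have [e2 e20 h2] := @param_near _ _ _ _ P a g Wg v y e1 v0 e10.
  exists e2 => // v' y' hv hy v'0 y'0; have [hP hY hc he] := h2 v' y' hv hy.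
  exact: h1 (dim_spacev hk1 UP Ua Wg v'0) (spacev_proj UP Wg v'0) hP hY hc he.
have dL := dim_spacev hk1 UP Ua Wg v0; have YL := lin_of_in g Ua v y.
have nd := param_nondeg hk1 UP Ua Wg v0 y0.
have bal i : imbalance (mu i) (spacev U g v) (lin_of a g v y) (cst_of y) (sq_of y) = 0.
  by have := hF (cast_ord (esym pq) i); rewrite /F cast_ordKV.
suff [B [rB hB]] : exists B : set 'rV[R]_d, sphere_region (spacev U g v) B /\
    forall i, (mu i (spacev U g v) (B : set (borelR R d)) * 2%:E = mu i (spacev U g v) setT)%E.
  exists (spacev U g v), B; split=> // j.
  apply: (subvP (addvSl _ _)); apply: (subvP sU); apply: memv_span.
  by apply/mapP; exists j; rewrite ?mem_enum.
(* For a negative coefficient of [|x|^2], pass to the opposite quadric: its two open regions are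
   exchanged, hence it is balanced too. *)
have [e0|e0] := lerP 0 (sq_of y); first exact: (balanced_region hk1 dL YL nd hmu bal e0).
apply: (@balanced_region R d k hk1 _ (- lin_of a g v y) (- cst_of y) (- sq_of y)) => //.
- by rewrite memvN.
- by case=> /eqP; rewrite oppr_eq0 => /eqP Y0 /eqP; rewrite oppr_eq0 => /eqP c0 /eqP;
    rewrite oppr_eq0 => /eqP s0; apply: nd.
- by move=> i; rewrite /imbalance !opprK -opprB -[_ - _]/(imbalance _ _ _ _ _) bal oppr0.
- by rewrite oppr_ge0 ltW.
Qed.
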